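(* Let $f$ be a modular form of weight $k\in 2\mathbb{Z}$ for $SL_2(\mathbb{Z})$, let $l\ge4$ be an even integer, and let $m\in\mathbb{N}_0$. If $f$ is not a cusp form, assume in addition that $l\ge k+2$. Let $\phi(\tau)=\sum_{n=0}^\infty a_nq^n$ be a $q$-series on the upper half-plane whose coefficients grow sufficiently slowly that $\mathbb{P}_l(\phi;\tau)$ is well-defined. Let $[f,\phi]_m$ denote the formal result of the $m$-th Rankin-Cohen bracket where $\phi$ is treated like a modular form of weight $l$, i.e. $$[f,\phi]_m=\sum_{j=0}^m(-1)^j\binom{k+m-1}{m-j}\binom{l+m-1}{j}D^jf\,D^{m-j}\phi.$$ Then $$[f,\mathbb{P}_l(\phi)]_m=\mathbb{P}_{k+l+2m}([f,\phi]_m).$$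
   Context: Let $\mathbb{H}$ be the upper half-plane, $\tau\in\mathbb{H}$, $q=e^{2\pi i\tau}$, and $D=\frac{1}{2\pi i}\frac{d}{d\tau}=q\frac{d}{dq}$. Let $\Gamma=SL_2(\mathbb{Z})$ and let $\Gamma_\infty\le\Gamma$ be the subgroup generated by $\pm\begin{pmatrix}1&1\\0&1\end{pmatrix}$. Modular forms of weight $k$ are holomorphic on $\mathbb{H}$, weight-$k$ invariant under $\Gamma$, with Fourier expansion $\sum_{n\ge0}a_nq^n$; a cusp form is a modular form with $a_0=0$. For $M=\begin{pmatrix}a&b\\c&d\end{pmatrix}\in\Gamma$ the weight $k$ slash operator is $(\phi|_kM)(\tau)=(c\tau+d)^{-k}\phi\left(\frac{a\tau+b}{c\tau+d}\right)$. Poincaré series: for even $k\ge4$ and a $q$-series $\phi(\tau)=\sum_{n=0}^\infty a_nq^n$ converging on $\mathbb{H}$, $$\mathbb{P}_k(\phi;\tau)=\sum_{M\in\Gamma_\infty\backslash\Gamma}(\phi|_kM)(\tau),$$ which is well-defined when this sum over cosets converges absolutely and uniformly on compact subsets of $\mathbb{H}$; it is then a modular form of weight $k$. Rankin-Cohen brackets: for modular forms $f,g$ of weights $k,l$ and $n\in\mathbb{N}_0$, $$[f,g]_n=\sum_{j=0}^n(-1)^j\binom{k+n-1}{n-j}\binom{l+n-1}{j}D^jf\,D^{n-j}g .$$ Convention: $\binom{x}{j}=x(x-1)\cdots(x-j+1)/j!$. *)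

(* Defs.v *)
From Stdlib Require Export Reals ZArith List ClassicalEpsilon.
From Coquelicot Require Export Coquelicot.

(* Stdlib world, with Coquelicot's complex numbers [C].  Functions on the upper
   half-plane are represented by total functions [C -> C], only the values at
   points of [upper_half_plane] being relevant. *)

Open Scope C_scope.

Definition upper_half_plane (tau : C) : Prop := (0 < Im tau)%R.

Definition Cexp (z : C) : C :=
  ((exp (Re z) * cos (Im z))%R, (exp (Re z) * sin (Im z))%R).

Definition q (tau : C) : C := Cexp (2 * PI * Ci * tau).

Definition CpowZ (z : C) (n : Z) : C :=
  match n with
  | Z0 => 1
  | Zpos p => z ^ Pos.to_nat p
  | Zneg p => / (z ^ Pos.to_nat p)
  end.

(* D = (1 / (2 pi i)) d/dtau, with the complex derivative. *)
Definition D (f : C -> C) (tau : C) : C := C_derive f tau / (2 * PI * Ci).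

Definition Dn (n : nat) (f : C -> C) : C -> C := Nat.iter n D f.

Definition has_q_expansion (a : nat -> C) (f : C -> C) : Prop :=
  forall tau, upper_half_plane tau ->
    is_pseries (K := C_AbsRing) (V := C_NormedModule) a (q tau) (f tau).

Record SL2Z := mkSL2Z {
  ma : Z; mb : Z; mc : Z; md : Z;
  SL2Z_det : (ma * md - mb * mc = 1)%Z
}.

Program Definition SL2Z_one : SL2Z := mkSL2Z 1 0 0 1 _.

Program Definition SL2Z_mul (M N : SL2Z) : SL2Z :=
  mkSL2Z (ma M * ma N + mb M * mc N) (ma M * mb N + mb M * md N)
         (mc M * ma N + md M * mc N) (mc M * mb N + md M * md N) _.
Next Obligation.
  transitivity ((ma M * md M - mb M * mc M) * (ma N * md N - mb N * mc N))%Z.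
  - ring.
  - rewrite !SL2Z_det; reflexivity.
Qed.

Program Definition SL2Z_inv (M : SL2Z) : SL2Z :=
  mkSL2Z (md M) (- mb M) (- mc M) (ma M) _.
Next Obligation. rewrite <- (SL2Z_det M); ring. Qed.

Program Definition SL2Z_T : SL2Z := mkSL2Z 1 1 0 1 _.

Program Definition SL2Z_minus_T : SL2Z := mkSL2Z (-1) (-1) 0 (-1) _.

Inductive Gamma_inf : SL2Z -> Prop :=
  | Gamma_inf_T : Gamma_inf SL2Z_T
  | Gamma_inf_minus_T : Gamma_inf SL2Z_minus_T
  | Gamma_inf_one : Gamma_inf SL2Z_one
  | Gamma_inf_mul M N : Gamma_inf M -> Gamma_inf N -> Gamma_inf (SL2Z_mul M N)
  | Gamma_inf_inv M : Gamma_inf M -> Gamma_inf (SL2Z_inv M).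

(* Gamma_inf \ Gamma, as the type of the sets Gamma_inf M. *)
Definition coset : Type :=
  { A : SL2Z -> Prop |
    exists M, forall N, A N <-> exists g, Gamma_inf g /\ N = SL2Z_mul g M }.

Definition coset_repr (A : coset) : SL2Z :=
  epsilon (inhabits SL2Z_one) (proj1_sig A).

Definition slash (k : Z) (phi : C -> C) (M : SL2Z) (tau : C) : C :=
  CpowZ (IZR (mc M) * tau + IZR (md M)) (- k) *
  phi ((IZR (ma M) * tau + IZR (mb M)) / (IZR (mc M) * tau + IZR (md M))).

Definition is_modular_form (k : Z) (f : C -> C) : Prop :=
  (forall tau, upper_half_plane tau ->
     ex_derive (K := C_AbsRing) (V := C_NormedModule) f tau) /\
  (forall (M : SL2Z) tau, upper_half_plane tau -> slash k f M tau = f tau) /\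
  (exists a : nat -> C, has_q_expansion a f).

Definition is_cusp_form (k : Z) (f : C -> C) : Prop :=
  is_modular_form k f /\
  exists a : nat -> C, has_q_expansion a f /\ a 0%nat = 0.

Definition fin_sum {I : Type} {G : AbelianGroup} (g : I -> G) (s : list I) : G :=
  fold_right plus zero (map g s).

(* The filter on the finite subsets of [I], directed by inclusion; a finite
   subset is given by a duplicate-free list. *)
Definition finite_subsets (I : Type) : (list I -> Prop) -> Prop :=
  fun P => exists s0, forall s, NoDup s -> incl s0 s -> P s.

Definition is_unordered_sum {I : Type} {K : AbsRing} {V : NormedModule K}
    (g : I -> V) (S : V) : Prop :=
  filterlim (fin_sum g) (finite_subsets I) (locally S).

Definition ex_unordered_sum {I : Type} {K : AbsRing} {V : NormedModule K}
    (g : I -> V) : Prop :=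
  exists S, is_unordered_sum g S.

Definition unordered_sum {I : Type} {K : AbsRing} {V : CompleteNormedModule K}
    (g : I -> V) : V :=
  iota (is_unordered_sum g).

Definition compact_set {T : UniformSpace} (X : T -> Prop) : Prop :=
  forall F : (T -> Prop) -> Prop,
    (forall U, F U -> open U) ->
    (forall x, X x -> exists U, F U /\ U x) ->
    exists l : list (T -> Prop),
      (forall U, In U l -> F U) /\
      (forall x, X x -> exists U, In U l /\ U x).

(* For even [k] and [phi] of period 1, in particular for a q-series, [slash k phi]
   is constant on cosets, so that the choice made by [coset_repr] is immaterial. *)
Definition poincare_term (k : Z) (phi : C -> C) (tau : C) (A : coset) : C :=
  slash k phi (coset_repr A) tau.

Definition poincare (k : Z) (phi : C -> C) (tau : C) : C :=
  unordered_sum (V := C_CompleteNormedModule) (poincare_term k phi tau).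

Definition poincare_well_defined (k : Z) (phi : C -> C) : Prop :=
  (forall tau, upper_half_plane tau ->
     ex_unordered_sum (V := R_NormedModule)
       (fun A => Cmod (poincare_term k phi tau A))) /\
  (forall X : C -> Prop,
     compact_set (T := C_UniformSpace) X ->
     (forall tau, X tau -> upper_half_plane tau) ->
     forall eps : posreal,
       finite_subsets coset (fun s =>
         forall tau, X tau ->
           (Cmod (fin_sum (G := C_AbelianGroup) (poincare_term k phi tau) s
                  - poincare k phi tau) < eps)%R)).

(* x (x - 1) ... (x - j + 1) *)
Fixpoint falling (x : Z) (j : nat) : Z :=
  match j with
  | O => 1%Z
  | S j' => (falling x j' * (x - Z.of_nat j'))%Z
  end.

Definition gbinom (x : Z) (j : nat) : R := (IZR (falling x j) / INR (fact j))%R.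

Definition rankin_cohen (k l : Z) (n : nat) (f g : C -> C) (tau : C) : C :=
  sum_n (G := C_AbelianGroup) (fun j : nat =>
    (-1) ^ j
    * gbinom (k + Z.of_nat n - 1) (n - j)
    * gbinom (l + Z.of_nat n - 1) j
    * Dn j f tau * Dn (n - j) g tau) n.

(* Main.v *)
Require Import Defs.
From Stdlib Require Import Lra Lia Psatz FunctionalExtensionality.

(** The series [poincare l phi] is a sum of the functions [slash l phi M], [M] running
    over representatives of the cosets, and the bracket [rankin_cohen k l m f] is linear
    in its second argument.  So the theorem amounts to two facts.

    The bracket may be applied term by term.  The finite partial sums converge to
    [poincare l phi] uniformly on compact sets along the filter of finite subsets; by
    Weierstrass' theorem, in the form [Weierstrass] for an arbitrary filter, so do all
    their derivatives, and the bracket is a finite combination of derivatives whose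
    coefficients, products of binomials and derivatives of [f], are locally bounded.
    Weierstrass' theorem rests on Cauchy's estimate [Cauchy_estimate], proved by
    differentiating an integral over circles with respect to the radius.  It also
    provides the derivatives of all orders of a q-series ([q_series_smooth]).

    The bracket commutes with the slash operator ([rankin_cohen_slash]).  The derivatives
    of [slash k f M] are polynomials in [y = - c / (2 pi i (c z + d))] whose coefficients
    are the functions [slash (k + 2 p) (Dn p f) M] ([slash_smooth]).  Up to normalization
    they form an Appell sequence in [y], each being an antiderivative of the preceding
    one, and the bracket is an alternating convolution of two such sequences.  Its
    derivative in [y] telescopes to zero, so that [y] may be replaced by [0], where only
    the expected bracket remains ([appell_convolution]).

    Since [f] is modular, [slash k f M] is [f].  Hence the bracket of [f] with the term of
    a coset in [poincare l phi] is the term of the same coset in the Poincaré series of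
    [rankin_cohen k l m f phi], and [loc_unif_poincare] reads off both claims from the
    locally uniform convergence of the sum of these terms.  Its absolute convergence is
    that of any unordered sum of complex numbers ([ex_unordered_sum_Cmod]). *)

Open Scope C_scope.
Arguments Cmod x%_C_scope.
Arguments Re z%_C_scope.
Arguments Im z%_C_scope.

(** Lemmas on sums over an abelian group leave equations in the carrier of that structure,
    where [ring] does not recognize the field of complex numbers. *)
Ltac eq_in_C := match goal with |- @eq _ ?x ?y => change (@eq C x y) end.
Ltac eq_in_R := match goal with |- @eq _ ?x ?y => change (@eq R x y) end.

(** * Complex derivatives *)

Definition is_cderive (f : C -> C) (z l : C) : Prop :=
  is_derive (K := C_AbsRing) (V := C_NormedModule) f z l.

(** [is_derive] involves two normed modules, with different underlying uniform structures;
    in terms of the modulus the distinction disappears. *)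
Lemma is_cderive_eps (f : C -> C) (z l : C) :
  is_cderive f z l <->
  forall eps : R, 0 < eps -> exists d : R, 0 < d /\
    forall h, Cmod h < d -> Cmod (f (z + h) - f z - h * l) <= eps * Cmod h.
Proof.
  split.
  - intros [_ H] eps Heps.
    destruct (H z (fun P HP => HP) (mkposreal eps Heps)) as [d Hd].
    exists d; split; [apply cond_pos|]. intros h Hh.
    specialize (Hd (z + h)).
    replace h with (z + h - z) at 2 3 by ring.
    apply Hd. change (Cmod (z + h - z) < d). now replace (z + h - z) with h by ring.
  - intros H. split; [apply is_linear_scal_l|].
    intros x Hx eps. apply (is_filter_lim_locally_unique (V := AbsRing_NormedModule C_AbsRing)) in Hx.
    subst x.
    destruct (H eps (cond_pos eps)) as [d [Hd0 Hd]].
    exists (mkposreal d Hd0). intros y Hy.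
    change (Cmod (y - z) < d) in Hy.
    specialize (Hd (y - z) Hy).
    assert (E : forall a b : C, a + (b - a) = b) by (intros; ring).
    rewrite E in Hd. exact Hd.
Qed.

Lemma locally_Cmod (z : C) (P : C -> Prop) (r : R) :
  (0 < r) -> (forall w, (Cmod (w - z) < r) -> P w) ->
  locally (T := AbsRing_UniformSpace C_AbsRing) z P.
Proof. intros Hr H. exists (mkposreal r Hr). exact H. Qed.

Lemma is_cderive_ext_ball (f g : C -> C) (z l : C) (r : R) :
  (0 < r) -> (forall w, (Cmod (w - z) < r) -> f w = g w) ->
  is_cderive f z l -> is_cderive g z l.
Proof.
  intros Hr H. apply is_derive_ext_loc. now apply locally_Cmod with r.
Qed.

Lemma is_cderive_const (c z : C) : is_cderive (fun _ => c) z 0.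
Proof. exact (is_derive_const (K := C_AbsRing) (V := C_NormedModule) c z). Qed.

Lemma is_cderive_id (z : C) : is_cderive (fun w => w) z 1.
Proof.
  apply is_cderive_eps. intros eps Heps. exists 1%R. split; [lra|]. intros h _.
  replace (z + h - z - h * 1) with (RtoC 0) by ring. rewrite Cmod_0.
  apply Rmult_le_pos; [lra|apply Cmod_ge_0].
Qed.

Lemma is_cderive_plus (f g : C -> C) (z a b : C) :
  is_cderive f z a -> is_cderive g z b -> is_cderive (fun w => f w + g w) z (a + b).
Proof. exact (is_derive_plus (K := C_AbsRing) (V := C_NormedModule) f g z a b). Qed.

Lemma is_cderive_scal (f : C -> C) (z a c : C) :
  is_cderive f z a -> is_cderive (fun w => c * f w) z (c * a).
Proof.
  intros H. rewrite is_cderive_eps in H |- *. intros eps Heps.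
  assert (Hc : 0 < Cmod c + 1) by (generalize (Cmod_ge_0 c); lra).
  destruct (H (eps / (Cmod c + 1))%R) as [d [Hd0 Hd]].
  { now apply Rdiv_lt_0_compat. }
  exists d; split; [easy|]. intros h Hh.
  replace (c * f (z + h) - c * f z - h * (c * a))
    with (c * (f (z + h) - f z - h * a)) by ring.
  rewrite Cmod_mult. specialize (Hd h Hh).
  apply Rle_trans with ((Cmod c + 1) * (eps / (Cmod c + 1) * Cmod h))%R.
  - apply Rmult_le_compat; try apply Cmod_ge_0; lra.
  - right. field. lra.
Qed.

Lemma is_cderive_minus (f g : C -> C) (z a b : C) :
  is_cderive f z a -> is_cderive g z b -> is_cderive (fun w => f w - g w) z (a - b).
Proof. exact (is_derive_minus (K := C_AbsRing) (V := C_NormedModule) f g z a b). Qed.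

Lemma is_cderive_lipschitz (f : C -> C) (z l : C) :
  is_cderive f z l ->
  exists d : R, 0 < d /\
    forall h, Cmod h < d -> Cmod (f (z + h) - f z) <= (Cmod l + 1) * Cmod h.
Proof.
  rewrite is_cderive_eps. intros H.
  destruct (H 1%R Rlt_0_1) as [d [Hd0 Hd]].
  exists d; split; [easy|]. intros h Hh.
  replace (f (z + h) - f z) with ((f (z + h) - f z - h * l) + h * l) by ring.
  eapply Rle_trans; [apply Cmod_triangle|]. rewrite Cmod_mult.
  specialize (Hd h Hh). lra.
Qed.

Lemma is_cderive_continuous (f : C -> C) (z l : C) :
  is_cderive f z l ->
  forall eps : R, 0 < eps -> exists d : R, 0 < d /\
    forall w, Cmod (w - z) < d -> Cmod (f w - f z) < eps.
Proof.
  intros H eps Heps.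
  destruct (is_cderive_lipschitz f z l H) as [d [Hd0 Hd]].
  assert (Hl : 0 < Cmod l + 1) by (generalize (Cmod_ge_0 l); lra).
  exists (Rmin d (eps / (Cmod l + 1))). split.
  { apply Rmin_pos; [easy|]. now apply Rdiv_lt_0_compat. }
  intros w Hw.
  assert (H1 := Rlt_le_trans _ _ _ Hw (Rmin_l _ _)).
  assert (H2 := Rlt_le_trans _ _ _ Hw (Rmin_r _ _)).
  specialize (Hd (w - z) H1). replace (z + (w - z)) with w in Hd by ring.
  eapply Rle_lt_trans; [exact Hd|].
  apply Rmult_lt_reg_r with (/ (Cmod l + 1))%R; [now apply Rinv_0_lt_compat|].
  replace ((Cmod l + 1) * Cmod (w - z) * / (Cmod l + 1))%R with (Cmod (w - z)).
  - exact H2.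
  - field. lra.
Qed.

Lemma is_cderive_mult (f g : C -> C) (z a b : C) :
  is_cderive f z a -> is_cderive g z b ->
  is_cderive (fun w => f w * g w) z (a * g z + f z * b).
Proof.
  intros Hf Hg. rewrite is_cderive_eps. intros eps Heps.
  destruct (is_cderive_continuous f z a Hf (eps / (3 * (Cmod b + 1)))%R) as [d3 [Hd3 H3]].
  { apply Rdiv_lt_0_compat; [easy|]. generalize (Cmod_ge_0 b); lra. }
  destruct (is_cderive_continuous f z a Hf 1%R Rlt_0_1) as [d4 [Hd4 H4]].
  rewrite is_cderive_eps in Hf, Hg.
  set (Mf := (Cmod (f z) + 1)%R). set (Mg := (Cmod (g z) + 1)%R).
  assert (HMf : 0 < Mf) by (unfold Mf; generalize (Cmod_ge_0 (f z)); lra).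
  assert (HMg : 0 < Mg) by (unfold Mg; generalize (Cmod_ge_0 (g z)); lra).
  destruct (Hf (eps / (3 * Mg))%R) as [d1 [Hd1 H1]].
  { apply Rdiv_lt_0_compat; lra. }
  destruct (Hg (eps / (3 * Mf))%R) as [d2 [Hd2 H2]].
  { apply Rdiv_lt_0_compat; lra. }
  exists (Rmin (Rmin d1 d2) (Rmin d3 d4)). split.
  { repeat apply Rmin_pos; easy. }
  intros h Hh.
  assert (Hh1 : Cmod h < Rmin d1 d2) by (eapply Rlt_le_trans; [exact Hh|apply Rmin_l]).
  assert (Hh2 : Cmod h < Rmin d3 d4) by (eapply Rlt_le_trans; [exact Hh|apply Rmin_r]).
  specialize (H1 h (Rlt_le_trans _ _ _ Hh1 (Rmin_l _ _))).
  specialize (H2 h (Rlt_le_trans _ _ _ Hh1 (Rmin_r _ _))).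
  assert (E : z + h - z = h) by ring.
  specialize (H3 (z + h)). specialize (H4 (z + h)). rewrite E in H3, H4.
  specialize (H3 (Rlt_le_trans _ _ _ Hh2 (Rmin_l _ _))).
  specialize (H4 (Rlt_le_trans _ _ _ Hh2 (Rmin_r _ _))).
  replace (f (z + h) * g (z + h) - f z * g z - h * (a * g z + f z * b)) with
    ((f (z + h) - f z - h * a) * g z + f (z + h) * (g (z + h) - g z - h * b)
     + (f (z + h) - f z) * b * h) by ring.
  assert (H4' : Cmod (f (z + h)) <= Mf).
  { replace (f (z + h)) with (f (z + h) - f z + f z) by ring.
    eapply Rle_trans; [apply Cmod_triangle|]. unfold Mf. lra. }
  eapply Rle_trans; [apply Cmod_triangle|].
  eapply Rle_trans; [apply Rplus_le_compat_r, Cmod_triangle|].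
  rewrite !Cmod_mult.
  assert (Hg0 := Cmod_ge_0 (g z)). assert (Hh0 := Cmod_ge_0 h). assert (Hb0 := Cmod_ge_0 b).
  assert (P1 : Cmod (f (z + h) - f z - h * a) * Cmod (g z) <= eps / 3 * Cmod h).
  { apply Rle_trans with (eps / (3 * Mg) * Cmod h * Mg)%R.
    - apply Rmult_le_compat; try apply Cmod_ge_0; [easy|unfold Mg; lra].
    - right. field. lra. }
  assert (P2 : Cmod (f (z + h)) * Cmod (g (z + h) - g z - h * b) <= eps / 3 * Cmod h).
  { apply Rle_trans with (Mf * (eps / (3 * Mf) * Cmod h))%R.
    - apply Rmult_le_compat; try apply Cmod_ge_0; easy.
    - right. field. lra. }
  assert (P3 : Cmod (f (z + h) - f z) * Cmod b * Cmod h <= eps / 3 * Cmod h).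
  { apply Rmult_le_compat_r; [easy|].
    apply Rle_trans with (eps / (3 * (Cmod b + 1)) * (Cmod b + 1))%R.
    - apply Rmult_le_compat; try apply Cmod_ge_0; lra.
    - right. field. lra. }
  lra.
Qed.

Lemma is_cderive_comp (f g : C -> C) (z a b : C) :
  is_cderive f (g z) a -> is_cderive g z b ->
  is_cderive (fun w => f (g w)) z (a * b).
Proof.
  intros Hf Hg. rewrite is_cderive_eps. intros eps Heps.
  destruct (is_cderive_lipschitz g z b Hg) as [d3 [Hd3 H3]].
  set (Mb := (Cmod b + 1)%R) in *.
  assert (HMb : 0 < Mb) by (unfold Mb; generalize (Cmod_ge_0 b); lra).
  set (Ma := (Cmod a + 1)%R) in *.
  assert (HMa : 0 < Ma) by (unfold Ma; generalize (Cmod_ge_0 a); lra).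
  rewrite is_cderive_eps in Hf, Hg.
  destruct (Hf (eps / (2 * Mb))%R) as [d1 [Hd1 H1]]; [apply Rdiv_lt_0_compat; lra|].
  destruct (Hg (eps / (2 * Ma))%R) as [d2 [Hd2 H2]]; [apply Rdiv_lt_0_compat; lra|].
  exists (Rmin (d1 / Mb) (Rmin d2 d3)). split.
  { repeat apply Rmin_pos; try easy. apply Rdiv_lt_0_compat; lra. }
  intros h Hh.
  assert (Hh1 : Cmod h < d1 / Mb) by (eapply Rlt_le_trans; [exact Hh|apply Rmin_l]).
  assert (Hh2 : Cmod h < Rmin d2 d3) by (eapply Rlt_le_trans; [exact Hh|apply Rmin_r]).
  specialize (H2 h (Rlt_le_trans _ _ _ Hh2 (Rmin_l _ _))).
  specialize (H3 h (Rlt_le_trans _ _ _ Hh2 (Rmin_r _ _))).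
  assert (Hk : Cmod (g (z + h) - g z) < d1).
  { eapply Rle_lt_trans; [exact H3|].
    apply Rmult_lt_compat_l with (r := Mb) in Hh1; [|easy].
    replace (Mb * (d1 / Mb))%R with d1 in Hh1 by (field; lra). exact Hh1. }
  specialize (H1 _ Hk).
  replace (g z + (g (z + h) - g z)) with (g (z + h)) in H1 by ring.
  replace (f (g (z + h)) - f (g z) - h * (a * b)) with
    ((f (g (z + h)) - f (g z) - (g (z + h) - g z) * a)
     + a * (g (z + h) - g z - h * b)) by ring.
  eapply Rle_trans; [apply Cmod_triangle|]. rewrite Cmod_mult.
  assert (P1 : Cmod (f (g (z + h)) - f (g z) - (g (z + h) - g z) * a) <= eps / 2 * Cmod h).
  { eapply Rle_trans; [exact H1|].
    apply Rle_trans with (eps / (2 * Mb) * (Mb * Cmod h))%R.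
    - apply Rmult_le_compat_l; [|easy]. apply Rlt_le, Rdiv_lt_0_compat; lra.
    - right. field. lra. }
  assert (P2 : Cmod a * Cmod (g (z + h) - g z - h * b) <= eps / 2 * Cmod h).
  { apply Rle_trans with (Ma * (eps / (2 * Ma) * Cmod h))%R.
    - apply Rmult_le_compat; try apply Cmod_ge_0; [unfold Ma; lra|easy].
    - right. field. lra. }
  lra.
Qed.

Lemma is_cderive_inv (z : C) : z <> 0 -> is_cderive Cinv z (- / (z * z)).
Proof.
  intros Hz. rewrite is_cderive_eps. intros eps Heps.
  assert (Hm : 0 < Cmod z) by now apply Cmod_gt_0.
  assert (Hm3 : 0 < eps * Cmod z ^ 3 / 2).
  { apply Rmult_lt_0_compat; [|lra]. apply Rmult_lt_0_compat; [easy|]. now apply pow_lt. }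
  exists (Rmin (Cmod z / 2) (eps * Cmod z ^ 3 / 2)). split.
  { apply Rmin_pos; lra. }
  intros h Hh.
  assert (H1 := Rlt_le_trans _ _ _ Hh (Rmin_l _ _)).
  assert (H2 := Rlt_le_trans _ _ _ Hh (Rmin_r _ _)).
  assert (H3 : Cmod z / 2 < Cmod (z + h)).
  { assert (T := Cmod_triangle (z + h) (- h)). rewrite Cmod_opp in T.
    replace (z + h + - h) with z in T by ring. lra. }
  assert (Hzh : z + h <> 0) by (apply Cmod_gt_0; lra).
  replace (/ (z + h) - / z - h * - / (z * z)) with (h * h / ((z + h) * (z * z)))
    by (field; split; easy).
  rewrite Cmod_div; [|repeat apply Cmult_neq_0; easy].
  rewrite !Cmod_mult.
  apply Rmult_le_reg_r with (Cmod (z + h) * (Cmod z * Cmod z))%R.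
  { repeat apply Rmult_lt_0_compat; lra. }
  unfold Rdiv. rewrite Rmult_assoc, Rinv_l, Rmult_1_r.
  2:{ apply Rgt_not_eq. repeat apply Rmult_lt_0_compat; lra. }
  apply Rle_trans with (eps * Cmod h * (Cmod z / 2 * (Cmod z * Cmod z)))%R.
  - replace (eps * Cmod h * (Cmod z / 2 * (Cmod z * Cmod z)))%R with
      (Cmod h * (eps * Cmod z ^ 3 / 2))%R by (simpl; field).
    apply Rmult_le_compat_l; [apply Cmod_ge_0|lra].
  - apply Rmult_le_compat_l.
    + apply Rmult_le_pos; [lra|apply Cmod_ge_0].
    + apply Rmult_le_compat_r; [|lra]. apply Rmult_le_pos; lra.
Qed.

(** * Complex derivatives along real paths *)

Lemma Cmod_le_Re_Im (z : C) : Cmod z <= Rabs (Re z) + Rabs (Im z).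
Proof.
  destruct z as [a b]. simpl.
  replace (a, b) with (RtoC a + Ci * RtoC b) by (apply injective_projections; simpl; ring).
  eapply Rle_trans; [apply Cmod_triangle|].
  rewrite Cmod_mult, Cmod_Ci, !Cmod_R. lra.
Qed.

Lemma im_le_Cmod (z : C) : Rabs (Im z) <= Cmod z.
Proof. exact (Rle_trans _ _ _ (Rmax_r _ _) (Rmax_Cmod z)). Qed.

Lemma is_derive_R_eps (f : R -> R) (x l : R) :
  (forall eps : R, 0 < eps -> exists d : R, 0 < d /\
    forall h, Rabs h < d -> Rabs (f (x + h)%R - f x - h * l) <= eps * Rabs h) ->
  is_derive f x l.
Proof.
  intros H. apply is_derive_Reals. intros eps Heps.
  destruct (H (eps / 2)%R) as [d [Hd0 Hd]]; [lra|].
  exists (mkposreal d Hd0). intros h Hh0 Hh.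
  specialize (Hd h Hh).
  replace ((f (x + h) - f x) / h - l)%R with ((f (x + h) - f x - h * l) / h)%R
    by (field; easy).
  rewrite Rabs_div by easy.
  assert (0 < Rabs h) by now apply Rabs_pos_lt.
  apply Rmult_lt_reg_r with (Rabs h); [easy|].
  unfold Rdiv. rewrite Rmult_assoc, Rinv_l, Rmult_1_r by lra. nra.
Qed.

Lemma is_derive_R_eps_inv (f : R -> R) (x l : R) :
  is_derive f x l ->
  forall eps : R, 0 < eps -> exists d : R, 0 < d /\
    forall h, Rabs h < d -> Rabs (f (x + h)%R - f x - h * l) <= eps * Rabs h.
Proof.
  intros H eps Heps. apply is_derive_Reals in H.
  destruct (H eps Heps) as [d Hd]. exists d. split; [apply cond_pos|].
  intros h Hh. destruct (Req_dec h 0) as [->|Hh0].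
  - replace (f (x + 0) - f x - 0 * l)%R with 0%R by (rewrite Rplus_0_r; ring).
    rewrite Rabs_R0. lra.
  - specialize (Hd h Hh0 Hh).
    replace (f (x + h) - f x - h * l)%R with (((f (x + h) - f x) / h - l) * h)%R
      by (field; easy).
    rewrite Rabs_mult. apply Rmult_le_compat_r; [apply Rabs_pos|lra].
Qed.

(** The chain rule along a real path: restricting a complex derivative to a curve is what
    reduces statements about [g] to one-variable calculus. *)
Lemma is_derive_path (g : C -> C) (a b : R -> R) (x a' b' : R) (l : C) :
  is_derive a x a' -> is_derive b x b' -> is_cderive g (a x, b x) l ->
  is_derive (fun s => Re (g (a s, b s))) x (Re (l * (a', b')))
  /\ is_derive (fun s => Im (g (a s, b s))) x (Im (l * (a', b'))).
Proof.
  intros Ha Hb Hg.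
  assert (H : forall eps : R, 0 < eps -> exists d : R, 0 < d /\
    forall h : R, Rabs h < d ->
      Cmod (g (a (x + h)%R, b (x + h)%R) - g (a x, b x) - h * (l * (a', b')))
      <= eps * Rabs h).
  { intros eps Heps.
    set (p' := (a', b') : C).
    rewrite is_cderive_eps in Hg.
    set (Mp := (Cmod p' + 1)%R). set (Ml := (Cmod l + 1)%R).
    assert (HMp : 0 < Mp) by (unfold Mp; generalize (Cmod_ge_0 p'); lra).
    assert (HMl : 0 < Ml) by (unfold Ml; generalize (Cmod_ge_0 l); lra).
    destruct (Hg (eps / (2 * Mp))%R) as [d1 [Hd1 H1]]; [apply Rdiv_lt_0_compat; lra|].
    (* The path deviates from its tangent by at most [2 * e * Rabs h]; [e <= 1 / 2] makes
       its Lipschitz constant at most [Mp]. *)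
    set (e := Rmin (1 / 2) (eps / (4 * Ml))).
    assert (He : 0 < e).
    { apply Rmin_pos; [lra|]. apply Rdiv_lt_0_compat; lra. }
    assert (He1 : e <= 1 / 2) by apply Rmin_l.
    assert (He2 : e <= eps / (4 * Ml)) by apply Rmin_r.
    destruct (is_derive_R_eps_inv _ _ _ Ha e He) as [d2 [Hd2 H2]].
    destruct (is_derive_R_eps_inv _ _ _ Hb e He) as [d3 [Hd3 H3]].
    exists (Rmin (d1 / Mp) (Rmin d2 d3)). split.
    { repeat apply Rmin_pos; try easy. now apply Rdiv_lt_0_compat. }
    intros h Hh.
    assert (Hh1 : Rabs h < d1 / Mp) by (eapply Rlt_le_trans; [exact Hh|apply Rmin_l]).
    assert (Hh2 : Rabs h < Rmin d2 d3) by (eapply Rlt_le_trans; [exact Hh|apply Rmin_r]).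
    specialize (H2 h (Rlt_le_trans _ _ _ Hh2 (Rmin_l _ _))).
    specialize (H3 h (Rlt_le_trans _ _ _ Hh2 (Rmin_r _ _))).
    set (k := ((a (x + h)%R, b (x + h)%R) : C) - (a x, b x)).
    assert (Hk : Cmod (k - h * p') <= 2 * e * Rabs h).
    { eapply Rle_trans; [apply Cmod_le_Re_Im|].
      replace (Re (k - h * p')) with (a (x + h) - a x - h * a')%R
        by (unfold k, p', Re; simpl; ring).
      replace (Im (k - h * p')) with (b (x + h) - b x - h * b')%R
        by (unfold k, p', Im; simpl; ring).
      lra. }
    assert (Hh0 := Rabs_pos h).
    assert (Hk2 : Cmod k <= Mp * Rabs h).
    { replace k with ((k - h * p') + h * p') by ring.
      eapply Rle_trans; [apply Cmod_triangle|]. rewrite Cmod_mult, Cmod_R.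
      unfold Mp. nra. }
    assert (Hk3 : Cmod k < d1).
    { eapply Rle_lt_trans; [exact Hk2|].
      apply Rmult_lt_compat_l with (r := Mp) in Hh1; [|easy].
      replace (Mp * (d1 / Mp))%R with d1 in Hh1 by (field; lra). exact Hh1. }
    specialize (H1 k Hk3).
    assert (E : forall w0 w1 : C, w0 + (w1 - w0) = w1) by (intros; ring).
    unfold k in H1 at 1. rewrite E in H1.
    replace (g (a (x + h)%R, b (x + h)%R) - g (a x, b x) - h * (l * p')) with
      ((g (a (x + h)%R, b (x + h)%R) - g (a x, b x) - k * l) + l * (k - h * p')) by ring.
    eapply Rle_trans; [apply Cmod_triangle|]. rewrite Cmod_mult.
    assert (P1 : Cmod (g (a (x + h)%R, b (x + h)%R) - g (a x, b x) - k * l)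
                 <= eps / 2 * Rabs h).
    { eapply Rle_trans; [exact H1|].
      apply Rle_trans with (eps / (2 * Mp) * (Mp * Rabs h))%R.
      - apply Rmult_le_compat_l; [|easy]. apply Rlt_le, Rdiv_lt_0_compat; lra.
      - right. field. lra. }
    assert (P2 : Cmod l * Cmod (k - h * p') <= eps / 2 * Rabs h).
    { apply Rle_trans with (Ml * (2 * (eps / (4 * Ml)) * Rabs h))%R.
      - apply Rmult_le_compat; try apply Cmod_ge_0; [unfold Ml; lra|].
        eapply Rle_trans; [exact Hk|]. apply Rmult_le_compat_r; lra.
      - right. field. lra. }
    lra. }
  split; apply is_derive_R_eps; intros eps Heps;
    destruct (H eps Heps) as [d [Hd0 Hd]]; exists d; (split; [easy|]);
    intros h Hh; specialize (Hd h Hh); (eapply Rle_trans; [|exact Hd]).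
  - eapply Rle_trans; [|apply re_le_Cmod]. right. f_equal. unfold Re; simpl. ring.
  - eapply Rle_trans; [|apply im_le_Cmod]. right. f_equal. unfold Im; simpl. ring.
Qed.

(** Multiplying by [u] turns an estimate of a modulus into an estimate of a real part. *)
Lemma exists_unimodular (w : C) : exists u : C, Cmod u = 1%R /\ u * w = Cmod w.
Proof.
  destruct (Req_dec (Cmod w) 0) as [H|H].
  - exists 1. rewrite Cmod_1. split; [easy|]. rewrite (Cmod_eq_0 w H), Cmod_0. ring.
  - assert (Hw : w <> 0) by (intros ->; apply H, Cmod_0).
    assert (HR : RtoC (Cmod w) <> 0) by (intros E; apply H; now injection E).
    exists (Cmod w / w). split.
    + rewrite Cmod_div by easy. rewrite Cmod_R, Rabs_pos_eq by apply Cmod_ge_0.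
      now field.
    + field. easy.
Qed.

(** Mean value inequality on a disc: a unimodular factor turns the complex increment into
    a real one, to which the real mean value theorem applies along the segment. *)
Lemma cderive_bound_increment (g g' : C -> C) (z h : C) (B : R) :
  (forall w, Cmod (w - z) <= Cmod h -> is_cderive g w (g' w) /\ Cmod (g' w) <= B) ->
  Cmod (g (z + h) - g z) <= B * Cmod h.
Proof.
  intros H.
  destruct (exists_unimodular (g (z + h) - g z)) as [u [Hu1 Hu2]].
  set (a := fun s : R => (Re z + s * Re h)%R).
  set (b := fun s : R => (Im z + s * Im h)%R).
  assert (Hab : forall s : R, ((a s, b s) : C) = z + s * h).
  { intros s. unfold a, b. apply injective_projections; unfold Re, Im; simpl; ring. }
  assert (Hin : forall s : R, 0 <= s <= 1 -> Cmod ((a s, b s) - z) <= Cmod h).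
  { intros s Hs. rewrite Hab. replace (z + s * h - z) with (s * h) by ring.
    rewrite Cmod_mult, Cmod_R, Rabs_pos_eq by easy.
    generalize (Cmod_ge_0 h); intros; nra. }
  set (G := fun s : R => Re (u * g (a s, b s))).
  set (G' := fun s : R => Re (u * g' (a s, b s) * h)).
  assert (Hd : forall s : R, 0 <= s <= 1 -> derivable_pt_lim G s (G' s)).
  { intros s Hs. apply is_derive_Reals.
    destruct (H (a s, b s) (Hin s Hs)) as [Hg _].
    assert (T := is_derive_path (fun w => u * g w) a b s (Re h) (Im h)
      (u * g' (a s, b s))).
    replace (G' s) with (Re (u * g' (a s, b s) * (Re h, Im h)))
      by (unfold G'; now destruct h).
    apply T.
    - unfold a. auto_derive; [easy|ring].
    - unfold b. auto_derive; [easy|ring].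
    - now apply is_cderive_scal. }
  destruct (MVT_cor2 G G' 0 1 Rlt_0_1 Hd) as [c [Hc1 Hc2]].
  assert (E0 : ((a 0%R, b 0%R) : C) = z) by (rewrite Hab; ring).
  assert (E1 : ((a 1%R, b 1%R) : C) = z + h) by (rewrite Hab; ring).
  assert (E : (G 1 - G 0)%R = Cmod (g (z + h) - g z)).
  { unfold G. rewrite E0, E1.
    replace (Cmod (g (z + h) - g z)) with (Re (u * (g (z + h) - g z)))
      by (rewrite Hu2; easy).
    unfold Re; simpl; ring. }
  rewrite <- E, Hc1.
  replace (G' c * (1 - 0))%R with (G' c) by ring.
  eapply Rle_trans; [apply Rle_abs|]. unfold G'.
  eapply Rle_trans; [apply re_le_Cmod|]. rewrite !Cmod_mult, Hu1, Rmult_1_l.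
  apply Rmult_le_compat_r; [apply Cmod_ge_0|].
  apply H, Hin. lra.
Qed.

(** * Cauchy's estimate *)

Lemma continuity_2d_pt_section (f : R -> R -> R) (x y : R) :
  continuity_2d_pt f x y -> continuous (fun v => f x v) y.
Proof.
  intros H. apply filterlim_locally. intros eps.
  destruct (H eps) as [d Hd]. exists d. intros v Hv. apply Hd; [|exact Hv].
  rewrite Rminus_diag, Rabs_R0. apply cond_pos.
Qed.

Lemma continuity_2d_pt_comp_C (F : C -> C) (a b : R -> R -> R) (x y : R) :
  (forall eps : R, 0 < eps -> exists d : R, 0 < d /\
     forall w, Cmod (w - (a x y, b x y)) < d -> Cmod (F w - F (a x y, b x y)) < eps) ->
  continuity_2d_pt a x y -> continuity_2d_pt b x y ->
  continuity_2d_pt (fun u v => Re (F (a u v, b u v))) x y /\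
  continuity_2d_pt (fun u v => Im (F (a u v, b u v))) x y.
Proof.
  intros HF Ha Hb.
  assert (H : forall eps : posreal,
    locally_2d (fun u v => Cmod (F (a u v, b u v) - F (a x y, b x y)) < eps) x y).
  { intros eps. destruct (HF eps (cond_pos eps)) as [d [Hd0 Hd]].
    assert (Hd2 : 0 < d / 2) by lra.
    generalize (locally_2d_and _ _ x y (Ha (mkposreal _ Hd2)) (Hb (mkposreal _ Hd2))).
    apply locally_2d_impl, locally_2d_forall. intros u v [H1 H2]. simpl in H1, H2.
    apply Hd. eapply Rle_lt_trans; [apply Cmod_le_Re_Im|].
    unfold Re, Im; simpl. unfold Rminus in H1, H2. lra. }
  split; intros eps; generalize (H eps); apply locally_2d_impl, locally_2d_forall;
    intros u v Huv; (eapply Rle_lt_trans; [|exact Huv]).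
  - eapply Rle_trans; [|apply re_le_Cmod]. right. f_equal.
  - eapply Rle_trans; [|apply im_le_Cmod]. right. f_equal.
Qed.

(** Let [n s] be the integral over [t] of the real part of [exp (- i t) g (z0 + s exp (i t))].
    Differentiating under the integral sign, [n' s] is the integral of the real part of
    [g' (z0 + s exp (i t))].  The imaginary part of [exp (- i t) g (z0 + s exp (i t))] is
    periodic in [t], and the integral of its derivative over a period vanishes: this says
    [n s = s * n' s].  Hence [n s / s] is constant for [s > 0]; it tends to
    [n' 0 = 2 pi Re (g' z0)] at [0], and it is at most [2 pi B / r] for [s = r].  The
    role of [g''] is to make [g'] continuous. *)
Lemma Cauchy_estimate_Re (g g' g'' : C -> C) (z0 : C) (r0 r B : R) :
  0 < r < r0 ->
  (forall w, Cmod (w - z0) < r0 -> is_cderive g w (g' w) /\ is_cderive g' w (g'' w)) ->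
  (forall w, Cmod (w - z0) < r0 -> Cmod (g w) <= B) ->
  r * Re (g' z0) <= B.
Proof.
  intros Hr Hd HB.
  set (a := fun s t => (Re z0 + s * cos t)%R).
  set (b := fun s t => (Im z0 + s * sin t)%R).
  assert (Hab : forall s t, Cmod ((a s t, b s t) - z0) = Rabs s).
  { intros s t.
    replace (((a s t, b s t) : C) - z0) with (s * (cos t, sin t)).
    - rewrite Cmod_mult, Cmod_R. unfold Cmod; simpl.
      replace (cos t * (cos t * 1) + sin t * (sin t * 1))%R with 1%R.
      + rewrite sqrt_1. ring.
      + generalize (sin2_cos2 t). unfold Rsqr. lra.
    - unfold a, b. apply injective_projections; unfold Re, Im; simpl; ring. }
  assert (Hin : forall s t, Rabs s < r0 -> Cmod ((a s t, b s t) - z0) < r0)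
    by (intros; now rewrite Hab).
  set (G := fun s t => (cos t * Re (g (a s t, b s t)) + sin t * Im (g (a s t, b s t)))%R).
  (* [G] and [W] are the real and imaginary parts of [exp (- i t) g (z0 + s exp (i t))]. *)
  set (W := fun s t => (cos t * Im (g (a s t, b s t)) - sin t * Re (g (a s t, b s t)))%R).
  set (P := fun s t => Re (g' (a s t, b s t))).
  assert (HGs : forall s t, Rabs s < r0 -> is_derive (fun s => G s t) s (P s t)).
  { intros s t Hs. destruct (Hd _ (Hin s t Hs)) as [H _].
    destruct (is_derive_path g (fun s => a s t) (fun s => b s t) s (cos t) (sin t)
      (g' (a s t, b s t))) as [H1 H2].
    - unfold a. auto_derive; [easy|ring].
    - unfold b. auto_derive; [easy|ring].
    - exact H.
    - evar_last.
      + apply (is_derive_plus (V := R_NormedModule));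
          [apply (is_derive_scal (fun s => Re (g (a s t, b s t))) s (cos t)), H1
          |apply (is_derive_scal (fun s => Im (g (a s t, b s t))) s (sin t)), H2].
      + unfold P, plus, Re, Im; simpl.
        transitivity (((cos t)^2 + (sin t)^2) * fst (g' (a s t, b s t)))%R; [ring|].
        generalize (sin2_cos2 t). rewrite !Rsqr_pow2. intros E.
        rewrite Rplus_comm, E. ring. }
  assert (HWt : forall s t, Rabs s < r0 ->
    is_derive (W s) t (- G s t + s * P s t)%R).
  { intros s t Hs. destruct (Hd _ (Hin s t Hs)) as [H _].
    destruct (is_derive_path g (a s) (b s) t (- s * sin t) (s * cos t)
      (g' (a s t, b s t))) as [H1 H2].
    - unfold a. auto_derive; [easy|ring].
    - unfold b. auto_derive; [easy|ring].
    - exact H.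
    - evar_last.
      + apply (is_derive_minus (V := R_NormedModule));
          [apply (is_derive_mult (fun t => cos t)%R (fun t => Im (g (a s t, b s t))) t);
             [apply is_derive_cos|exact H2|exact Rmult_comm]
          |apply (is_derive_mult (fun t => sin t)%R (fun t => Re (g (a s t, b s t))) t);
             [apply is_derive_sin|exact H1|exact Rmult_comm]].
      + unfold G, P, minus, plus, opp, mult, Re, Im; simpl. unfold mult; simpl.
        transitivity (- (cos t * fst (g (a s t, b s t)) + sin t * snd (g (a s t, b s t)))
          + s * (((sin t)^2 + (cos t)^2) * fst (g' (a s t, b s t))))%R; [ring|].
        generalize (sin2_cos2 t). rewrite !Rsqr_pow2. intros E.
        rewrite E. ring. }
  assert (Ha : forall s t, continuity_2d_pt a s t).
  { intros s t. unfold a. apply continuity_2d_pt_plus; [apply continuity_2d_pt_const|].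
    apply continuity_2d_pt_mult; [apply continuity_2d_pt_id1|].
    apply (continuity_1d_2d_pt_comp cos (fun _ v => v)); [apply continuity_cos|].
    apply continuity_2d_pt_id2. }
  assert (Hb : forall s t, continuity_2d_pt b s t).
  { intros s t. unfold b. apply continuity_2d_pt_plus; [apply continuity_2d_pt_const|].
    apply continuity_2d_pt_mult; [apply continuity_2d_pt_id1|].
    apply (continuity_1d_2d_pt_comp sin (fun _ v => v)); [apply continuity_sin|].
    apply continuity_2d_pt_id2. }
  assert (HP : forall s t, Rabs s < r0 -> continuity_2d_pt P s t).
  { intros s t Hs. destruct (Hd _ (Hin s t Hs)) as [_ H].
    apply (continuity_2d_pt_comp_C g' a b); [|easy|easy].
    eapply is_cderive_continuous, H. }
  assert (HG : forall s t, Rabs s < r0 -> continuity_2d_pt G s t).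
  { intros s t Hs. destruct (Hd _ (Hin s t Hs)) as [H _].
    destruct (continuity_2d_pt_comp_C g a b s t) as [H1 H2]; [|easy|easy|].
    { eapply is_cderive_continuous, H. }
    apply continuity_2d_pt_plus; apply continuity_2d_pt_mult; try easy.
    - apply (continuity_1d_2d_pt_comp cos (fun _ v => v)); [apply continuity_cos|].
      apply continuity_2d_pt_id2.
    - apply (continuity_1d_2d_pt_comp sin (fun _ v => v)); [apply continuity_sin|].
      apply continuity_2d_pt_id2. }
  assert (HexG : forall s, Rabs s < r0 -> ex_RInt (G s) 0 (2 * PI)).
  { intros s Hs. apply (ex_RInt_continuous (V := R_CompleteNormedModule)).
    intros t _. now apply continuity_2d_pt_section, HG. }
  assert (HexP : forall s, Rabs s < r0 -> ex_RInt (P s) 0 (2 * PI)).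
  { intros s Hs. apply (ex_RInt_continuous (V := R_CompleteNormedModule)).
    intros t _. now apply continuity_2d_pt_section, HP. }
  assert (Hloc : forall s, Rabs s < r0 -> locally s (fun y : R => Rabs y < r0)).
  { intros s Hs. assert (Hp : 0 < r0 - Rabs s) by lra.
    exists (mkposreal _ Hp). intros y Hy.
    change (Rabs (y - s) < r0 - Rabs s) in Hy.
    generalize (Rabs_triang (y - s) s).
    rewrite (Rplus_comm (y - s) s), Rplus_minus. lra. }
  set (n := (fun s => RInt (G s) 0 (2 * PI)) : R -> R).
  set (n' := (fun s => RInt (P s) 0 (2 * PI)) : R -> R).
  assert (Hn : forall s, Rabs s < r0 -> is_derive n s (n' s)).
  { intros s Hs. unfold n, n'.
    rewrite (RInt_ext (P s) (fun t => Derive (fun u => G u t) s)).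
    2:{ intros t _. symmetry. now apply is_derive_unique, HGs. }
    apply (is_derive_RInt_param G 0 (2 * PI) s).
    - generalize (Hloc s Hs). apply filter_imp. intros y Hy t _.
      eexists. now apply HGs.
    - intros t _. apply continuity_2d_pt_ext_loc with P; [|now apply HP].
      destruct (Hloc s Hs) as [d Hd']. exists d. intros u v Hu _.
      symmetry. apply is_derive_unique, HGs, Hd', Hu.
    - generalize (Hloc s Hs). apply filter_imp. intros y Hy. now apply HexG. }
  assert (Hnn' : forall s, Rabs s < r0 -> n s = (s * n' s)%R).
  { intros s Hs.
    assert (H : is_RInt (fun t => - G s t + s * P s t)%R 0 (2 * PI) 0%R).
    { replace 0%R with (minus (W s (2 * PI)%R) (W s 0%R)) at 2.
      - apply (is_RInt_derive (V := R_CompleteNormedModule)); intros t _.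
        + now apply HWt.
        + apply (continuous_plus (V := R_NormedModule) (fun t => - G s t)%R
            (fun t => s * P s t)%R).
          * apply (continuous_opp (V := R_NormedModule) (G s)). now apply continuity_2d_pt_section, HG.
          * apply (continuous_scal_r (V := R_NormedModule) s (P s)). now apply continuity_2d_pt_section, HP.
      - replace (W s (2 * PI)%R) with (W s 0%R)
          by (unfold W, a, b; now rewrite cos_2PI, sin_2PI, cos_0, sin_0).
        exact (minus_eq_zero (G := R_AbelianGroup) (W s 0%R)). }
    assert (H2 : is_RInt (fun t => - G s t + s * P s t)%R 0 (2 * PI) (- n s + s * n' s)%R).
    { apply (is_RInt_plus (V := R_NormedModule)).
      - apply (is_RInt_opp (V := R_NormedModule)).
        apply (RInt_correct (V := R_CompleteNormedModule)), HexG, Hs.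
      - apply (is_RInt_scal (V := R_NormedModule)).
        apply (RInt_correct (V := R_CompleteNormedModule)), HexP, Hs. }
    apply (is_RInt_unique (V := R_CompleteNormedModule)) in H.
    apply (is_RInt_unique (V := R_CompleteNormedModule)) in H2.
    rewrite H in H2. lra. }
  assert (Hconst : forall e, 0 < e < r -> (n e / e)%R = (n r / r)%R).
  { intros e He.
    apply (eq_is_derive (V := R_NormedModule) (fun s => n s / s)%R e r); [|lra].
    intros s Hs. assert (Hs' : Rabs s < r0) by (rewrite Rabs_pos_eq; lra).
    evar_last.
    - apply is_derive_div; [now apply Hn|apply (is_derive_id (K := R_AbsRing))|lra].
    - rewrite (Hnn' s Hs'). change ((n' s * s - s * n' s * 1) / s ^ 2 = 0)%R. field. lra. }
  assert (E0 : Rabs 0 < r0) by (rewrite Rabs_R0; lra).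
  assert (Hn0 : n 0%R = 0%R) by (rewrite (Hnn' _ E0); ring).
  assert (HP0 : n' 0%R = (2 * PI * Re (g' z0))%R).
  { unfold n'. rewrite (RInt_ext (P 0%R) (fun _ => Re (g' z0))).
    - rewrite (RInt_const (V := R_CompleteNormedModule)).
      change ((2 * PI - 0) * Re (g' z0) = 2 * PI * Re (g' z0))%R. ring.
    - intros t _. unfold P, a, b. rewrite !Rmult_0_l, !Rplus_0_r. now destruct z0. }
  assert (HPI := PI_RGT_0).
  assert (Hlim : (n r / r)%R = n' 0%R).
  { apply Rminus_diag_uniq. apply cond_eq. intros eps Heps.
    destruct (is_derive_R_eps_inv n 0 (n' 0%R) (Hn _ E0) (eps / 2)%R) as [d [Hd0 Hd']];
      [lra|].
    set (e := (Rmin d r / 2)%R).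
    assert (He : 0 < e /\ e < d /\ e < r).
    { assert (0 < Rmin d r) by (apply Rmin_pos; lra).
      generalize (Rmin_l d r) (Rmin_r d r). unfold e. lra. }
    rewrite <- (Hconst e) by lra. rewrite Rminus_0_r.
    specialize (Hd' e). rewrite (Rabs_pos_eq e) in Hd' by lra.
    rewrite Rplus_0_l, Hn0, Rminus_0_r in Hd'.
    replace (n e / e - n' 0)%R with ((n e - e * n' 0) / e)%R by (field; lra).
    rewrite Rabs_div by lra. rewrite (Rabs_pos_eq e) by lra.
    apply Rle_lt_trans with (eps / 2)%R; [|lra].
    apply Rmult_le_reg_r with e; [lra|].
    unfold Rdiv. rewrite Rmult_assoc, Rinv_l, Rmult_1_r by lra. apply Hd'; lra. }
  assert (Er : Rabs r < r0) by (rewrite Rabs_pos_eq; lra).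
  assert (HnB : n r <= 2 * PI * B).
  { replace (2 * PI * B)%R with (RInt (V := R_CompleteNormedModule) (fun _ => B) 0 (2 * PI)).
    2:{ rewrite RInt_const. change ((2 * PI - 0) * B = 2 * PI * B)%R. ring. }
    apply RInt_le; [lra|now apply HexG|apply ex_RInt_const|].
    intros t _.
    apply Rle_trans with (Cmod ((cos t, (- sin t)%R) * g (a r t, b r t))).
    - eapply Rle_trans; [|apply re_le_Cmod]. eapply Rle_trans; [|apply Rle_abs].
      right. unfold G, Re, Im; simpl. ring.
    - rewrite Cmod_mult. replace (Cmod (cos t, (- sin t)%R)) with 1%R.
      + rewrite Rmult_1_l. now apply HB, Hin.
      + unfold Cmod; simpl.
        replace (cos t * (cos t * 1) + - sin t * (- sin t * 1))%R with 1%R.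
        * now rewrite sqrt_1.
        * generalize (sin2_cos2 t). unfold Rsqr. lra. }
  rewrite HP0 in Hlim.
  assert (E : n r = (2 * PI * (r * Re (g' z0)))%R).
  { replace (n r) with (n r / r * r)%R by (field; lra). rewrite Hlim. ring. }
  rewrite E in HnB. apply Rmult_le_reg_l with (2 * PI)%R; lra.
Qed.

Lemma Cauchy_estimate (g g' g'' : C -> C) (z0 : C) (r0 r B : R) :
  0 < r < r0 ->
  (forall w, Cmod (w - z0) < r0 -> is_cderive g w (g' w) /\ is_cderive g' w (g'' w)) ->
  (forall w, Cmod (w - z0) < r0 -> Cmod (g w) <= B) ->
  r * Cmod (g' z0) <= B.
Proof.
  intros Hr Hd HB.
  destruct (exists_unimodular (g' z0)) as [u [Hu1 Hu2]].
  replace (Cmod (g' z0)) with (Re (u * g' z0)) by (rewrite Hu2; easy).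
  apply (Cauchy_estimate_Re (fun w => u * g w) (fun w => u * g' w) (fun w => u * g'' w)
    z0 r0 r B Hr).
  - intros w Hw. destruct (Hd w Hw). split; now apply is_cderive_scal.
  - intros w Hw. rewrite Cmod_mult, Hu1, Rmult_1_l. now apply HB.
Qed.

(** * Weierstrass' theorem on the upper half-plane *)

Definition two_pi_i : C := 2 * PI * Ci.

Lemma Cmod_two_pi_i : Cmod two_pi_i = (2 * PI)%R.
Proof.
  unfold two_pi_i. rewrite !Cmod_mult, Cmod_Ci, !Cmod_R.
  generalize PI_RGT_0; intros. rewrite !Rabs_pos_eq; lra.
Qed.

Lemma two_pi_i_neq_0 : two_pi_i <> 0.
Proof. apply Cmod_gt_0. rewrite Cmod_two_pi_i. generalize PI_RGT_0; lra. Qed.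

Lemma upper_half_plane_ball (z w : C) :
  Cmod (w - z) < Im z -> upper_half_plane w.
Proof.
  intros H. unfold upper_half_plane.
  generalize (im_le_Cmod (w - z)). unfold Im; simpl. intros H1.
  assert (H2 := Rle_abs (- (snd w + - snd z))). rewrite Rabs_Ropp in H2.
  unfold Im in H. lra.
Qed.

Lemma D_unique (f : C -> C) (z l : C) : is_cderive f z l -> D f z = l / two_pi_i.
Proof. intros H. unfold D. now rewrite (is_C_derive_unique f z l H). Qed.

(** Stating differentiability of all orders with the value of the derivative makes [smooth]
    closed under [D] by mere reindexing. *)
Definition smooth (f : C -> C) : Prop :=
  forall n z, upper_half_plane z -> is_cderive (Dn n f) z (two_pi_i * Dn (S n) f z).

Lemma is_cderive_D (f : C -> C) (z l : C) :
  is_cderive f z l -> is_cderive f z (two_pi_i * D f z).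
Proof.
  intros H. rewrite (D_unique f z l H).
  replace (two_pi_i * (l / two_pi_i)) with l; [easy|].
  field. apply two_pi_i_neq_0.
Qed.

Lemma Dn_add (m n : nat) (f : C -> C) : Dn m (Dn n f) = Dn (m + n) f.
Proof. induction m as [|m IH]; [easy|]. simpl in *. now rewrite IH. Qed.

Lemma smooth_Dn (n : nat) (f : C -> C) : smooth f -> smooth (Dn n f).
Proof.
  intros H m z Hz. change (Dn (S m) (Dn n f) z) with (D (Dn m (Dn n f)) z).
  rewrite Dn_add. exact (H (m + n)%nat z Hz).
Qed.

Lemma D_ext (f g : C -> C) :
  (forall z, upper_half_plane z -> ex_derive (K := C_AbsRing) (V := C_NormedModule) f z) ->
  (forall z, upper_half_plane z -> f z = g z) ->
  forall z, upper_half_plane z -> D f z = D g z.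
Proof.
  intros Hf Hfg z Hz. destruct (Hf z Hz) as [l Hl].
  rewrite (D_unique f z l Hl). symmetry. apply D_unique.
  apply is_cderive_ext_ball with f (Im z); [exact Hz| |exact Hl].
  intros w Hw. now apply Hfg, upper_half_plane_ball with z.
Qed.

Lemma Dn_ext (f g : C -> C) (n : nat) :
  smooth f -> (forall z, upper_half_plane z -> f z = g z) ->
  forall z, upper_half_plane z -> Dn n f z = Dn n g z.
Proof.
  intros Hf Hfg. induction n as [|n IH]; [exact Hfg|].
  apply (D_ext (Dn n f)); [|exact IH].
  intros z Hz. eexists. exact (Hf n z Hz).
Qed.

(** Convergence is required near each point of the half-plane rather than on compact sets:
    this form localizes immediately, and the two agree by [loc_unif_compact]. *)
Definition loc_unif {T : Type} (F : (T -> Prop) -> Prop) (G : T -> C -> C) (g : C -> C) :=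
  forall z, upper_half_plane z -> exists r, 0 < r /\ forall eps : R, 0 < eps ->
    F (fun t => forall w, Cmod (w - z) < r -> Cmod (G t w - g w) < eps).

Lemma loc_unif_pointwise {T : Type} (F : (T -> Prop) -> Prop) {FF : Filter F} G g z :
  loc_unif F G g -> upper_half_plane z ->
  forall eps : R, 0 < eps -> F (fun t => Cmod (G t z - g z) < eps).
Proof.
  intros H Hz eps Heps. destruct (H z Hz) as [r [Hr Hu]].
  generalize (Hu eps Heps). apply filter_imp. intros t Ht. apply Ht.
  replace (z - z) with (RtoC 0) by ring. now rewrite Cmod_0.
Qed.

Lemma loc_unif_ext {T : Type} (F : (T -> Prop) -> Prop) {FF : Filter F}
  (G G' : T -> C -> C) (g g' : C -> C) :
  (forall t z, upper_half_plane z -> G t z = G' t z) ->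
  (forall z, upper_half_plane z -> g z = g' z) ->
  loc_unif F G g -> loc_unif F G' g'.
Proof.
  intros HG Hg H z Hz. destruct (H z Hz) as [r [Hr Hu]].
  exists (Rmin r (Im z)). split; [now apply Rmin_pos|].
  intros eps Heps. generalize (Hu eps Heps). apply filter_imp. intros t Ht w Hw.
  assert (H1 := Rlt_le_trans _ _ _ Hw (Rmin_l _ _)).
  assert (H2 := Rlt_le_trans _ _ _ Hw (Rmin_r _ _)).
  apply upper_half_plane_ball in H2.
  rewrite <- HG, <- Hg by easy. now apply Ht.
Qed.

(** The uniform structure of the complex plane is that of a product, with square balls;
    limits are nevertheless described by the modulus. *)
Lemma filterlim_C_iff {T : Type} (F : (T -> Prop) -> Prop) {FF : Filter F}
  (f : T -> C) (l : C) :
  filterlim f F (locally (T := C_UniformSpace) l) <->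
  forall eps : R, 0 < eps -> F (fun t => Cmod (f t - l) < eps).
Proof.
  split.
  - intros H eps Heps.
    assert (He : 0 < eps / sqrt 2) by (apply Rdiv_lt_0_compat; [easy|apply sqrt_lt_R0; lra]).
    assert (H1 := proj1 (filterlim_locally (U := C_UniformSpace) f l) H (mkposreal _ He)).
    revert H1. apply filter_imp. intros t Ht.
    apply C_NormedModule_mixin_compat2 in Ht. simpl in Ht.
    replace (sqrt 2 * (eps / sqrt 2))%R with eps in Ht; [exact Ht|].
    field. apply Rgt_not_eq, sqrt_lt_R0. lra.
  - intros H. apply (filterlim_locally (U := C_UniformSpace)). intros eps.
    generalize (H eps (cond_pos eps)). apply filter_imp. intros t Ht.
    now apply C_NormedModule_mixin_compat1.
Qed.

Lemma filter_C_complete {T : Type} (F : (T -> Prop) -> Prop) {FF : ProperFilter F}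
  (f : T -> C) :
  (forall eps : R, 0 < eps -> exists P, F P /\
     forall s t, P s -> P t -> Cmod (f s - f t) < eps) ->
  exists l, forall eps : R, 0 < eps -> F (fun t => Cmod (f t - l) < eps).
Proof.
  intros H.
  destruct (proj1 (filterlim_locally_cauchy (U := C_CompleteNormedModule) (F := F) f))
    as [l Hl].
  - intros eps. destruct (H eps (cond_pos eps)) as [P [HP HP2]].
    exists P. split; [easy|]. intros u v Hu Hv.
    apply C_NormedModule_mixin_compat1. now apply HP2.
  - exists l. exact (proj1 (filterlim_C_iff F f l) Hl).
Qed.

(** By Cauchy's estimate applied to the differences [G s - G t], the derivatives form a
    Cauchy family, uniformly on a smaller disc. *)
Lemma Weierstrass_derivatives_converge {T : Type} (F : (T -> Prop) -> Prop)
  {FF : ProperFilter F} (G : T -> C -> C) (g : C -> C) :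
  (forall t, smooth (G t)) -> loc_unif F G g ->
  exists L, loc_unif F (fun t => D (G t)) L.
Proof.
  intros HG Hg.
  assert (HC : forall z, upper_half_plane z -> exists r, 0 < r /\
    forall eps : R, 0 < eps -> exists P, F P /\ forall s t, P s -> P t ->
      forall w, Cmod (w - z) < r -> Cmod (D (G s) w - D (G t) w) < eps).
  { intros z Hz. destruct (Hg z Hz) as [r0 [Hr0 Hu]].
    set (r := Rmin r0 (Im z)).
    assert (Hr : 0 < r) by now apply Rmin_pos.
    assert (Hrl : r <= r0) by apply Rmin_l. assert (Hrr : r <= Im z) by apply Rmin_r.
    exists (r / 2)%R. split; [lra|]. intros eps Heps.
    (* Cauchy's estimate on circles of radius [r / 4] divides by this radius. *)
    assert (He : 0 < eps * (r / 4)) by (apply Rmult_lt_0_compat; lra).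
    exists (fun t => forall w, Cmod (w - z) < r0 -> Cmod (G t w - g w) < eps * (r / 4)).
    split; [now apply Hu|]. intros s t Hs Ht w Hw.
    assert (Hball : forall w', Cmod (w' - w) < r / 2 -> Cmod (w' - z) < r).
    { intros w' Hw'. replace (w' - z) with ((w' - w) + (w - z)) by ring.
      eapply Rle_lt_trans; [apply Cmod_triangle|]. lra. }
    assert (E := Cauchy_estimate (fun w => G s w - G t w)
      (fun w => two_pi_i * D (G s) w - two_pi_i * D (G t) w)
      (fun w => two_pi_i * (two_pi_i * D (D (G s)) w)
         - two_pi_i * (two_pi_i * D (D (G t)) w))
      w (r / 2) (r / 4) (2 * (eps * (r / 4)))).
    assert (E' : r / 4 * Cmod (two_pi_i * D (G s) w - two_pi_i * D (G t) w)
                 <= 2 * (eps * (r / 4))).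
    { apply E; [lra| |].
      - intros w' Hw'.
        assert (Hw'H : upper_half_plane w').
        { apply upper_half_plane_ball with z. specialize (Hball w' Hw'). lra. }
        split; apply is_cderive_minus.
        + exact (HG s 0%nat w' Hw'H).
        + exact (HG t 0%nat w' Hw'H).
        + apply is_cderive_scal. exact (HG s 1%nat w' Hw'H).
        + apply is_cderive_scal. exact (HG t 1%nat w' Hw'H).
      - intros w' Hw'.
        assert (Hw'2 : Cmod (w' - z) < r0) by (specialize (Hball w' Hw'); lra).
        replace (G s w' - G t w') with ((G s w' - g w') + - (G t w' - g w')) by ring.
        eapply Rle_trans; [apply Cmod_triangle|]. rewrite Cmod_opp.
        specialize (Hs w' Hw'2). specialize (Ht w' Hw'2). lra. }
    replace (two_pi_i * D (G s) w - two_pi_i * D (G t) w) with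
      (two_pi_i * (D (G s) w - D (G t) w)) in E' by ring.
    rewrite Cmod_mult, Cmod_two_pi_i in E'.
    set (x := Cmod (D (G s) w - D (G t) w)) in *.
    assert (HPI := PI2_1).
    assert (Hx : 0 <= x) by apply Cmod_ge_0.
    assert (E2 : PI * x <= eps).
    { apply Rmult_le_reg_l with (2 * (r / 4))%R; lra. }
    nra. }
  assert (HL : forall z, exists l, upper_half_plane z ->
    forall eps : R, 0 < eps -> F (fun t => Cmod (D (G t) z - l) < eps)).
  { intros z. destruct (excluded_middle_informative (upper_half_plane z)) as [Hz|Hz].
    - destruct (HC z Hz) as [r [Hr Hu]].
      destruct (filter_C_complete F (fun t => D (G t) z)) as [l Hl].
      + intros eps Heps. destruct (Hu eps Heps) as [P [HP HP2]].
        exists P. split; [easy|]. intros s t Hs Ht. apply HP2; try easy.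
        replace (z - z) with (RtoC 0) by ring. now rewrite Cmod_0.
      + now exists l.
    - now exists 0. }
  exists (fun z => epsilon (inhabits (RtoC 0)) (fun l => upper_half_plane z ->
    forall eps : R, 0 < eps -> F (fun t => Cmod (D (G t) z - l) < eps))).
  intros z Hz. destruct (HC z Hz) as [r [Hr Hu]].
  exists (Rmin r (Im z)). split; [now apply Rmin_pos|]. intros eps Heps.
  destruct (Hu (eps / 2)%R) as [P [HP HP2]]; [lra|].
  generalize HP. apply filter_imp. intros t Ht w Hw.
  assert (H1 := Rlt_le_trans _ _ _ Hw (Rmin_l _ _)).
  assert (H2 := Rlt_le_trans _ _ _ Hw (Rmin_r _ _)).
  apply upper_half_plane_ball in H2.
  set (Lw := epsilon _ _).
  assert (HLw : forall eps : R, 0 < eps -> F (fun t => Cmod (D (G t) w - Lw) < eps))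
    by exact (epsilon_spec (inhabits (RtoC 0)) _ (HL w) H2).
  assert (He2 : 0 < eps / 2) by lra.
  destruct (filter_ex _ (filter_and _ _ HP (HLw (eps / 2)%R He2))) as [s [Hs1 Hs2]].
  replace (D (G t) w - Lw) with ((D (G t) w - D (G s) w) + (D (G s) w - Lw)) by ring.
  eapply Rle_lt_trans; [apply Cmod_triangle|].
  specialize (HP2 t s Ht Hs1 w H1). lra.
Qed.

(** On a small disc the derivatives of [G s - G t] are small, so [G s - G t] has a small
    Lipschitz constant, and so has [g - G t] in the limit.  Thus [g] inherits
    differentiability from a single well-chosen [G t]. *)
Lemma is_cderive_limit {T : Type} (F : (T -> Prop) -> Prop)
  {FF : ProperFilter F} (G : T -> C -> C) (g L : C -> C) :
  (forall t, smooth (G t)) -> loc_unif F G g -> loc_unif F (fun t => D (G t)) L ->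
  forall z, upper_half_plane z -> is_cderive g z (two_pi_i * L z).
Proof.
  intros HG Hg HL z Hz. apply is_cderive_eps. intros eps Heps.
  destruct (Hg z Hz) as [r1 [Hr1 Hu1]]. destruct (HL z Hz) as [r2 [Hr2 Hu2]].
  set (r := Rmin (Rmin r1 r2) (Im z)).
  assert (Hr : 0 < r) by (repeat apply Rmin_pos; easy).
  assert (Hrl : r <= Rmin r1 r2) by apply Rmin_l. assert (Hrr : r <= Im z) by apply Rmin_r.
  assert (Hrl1 : r <= r1) by (eapply Rle_trans; [exact Hrl|apply Rmin_l]).
  assert (Hrl2 : r <= r2) by (eapply Rle_trans; [exact Hrl|apply Rmin_r]).
  assert (HPI := PI_RGT_0).
  (* The errors below add up to [4 PI e + e + 2 PI e] times [Cmod h]. *)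
  set (e := (eps / (6 * PI + 1))%R).
  assert (He : 0 < e) by (apply Rdiv_lt_0_compat; lra).
  specialize (Hu2 e He).
  destruct (filter_ex _ Hu2) as [t Ht].
  assert (Hz0 : Cmod (z - z) < r)
    by (replace (z - z) with (RtoC 0) by ring; now rewrite Cmod_0).
  (* The increment of [g - G t], obtained from that of [G s - G t] in the limit. *)
  assert (Hinc : forall h, Cmod h < r ->
    Cmod ((g (z + h) - g z) - (G t (z + h) - G t z)) <= 4 * PI * e * Cmod h).
  { intros h Hh. apply Rle_plus_epsilon. intros d Hd.
    assert (Hd2 : 0 < d / 2) by lra.
    destruct (filter_ex _ (filter_and _ _ Hu2 (Hu1 (d / 2)%R Hd2))) as [s [Hs2 Hs1]].
    assert (B := cderive_bound_increment (fun w => G s w - G t w)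
      (fun w => two_pi_i * D (G s) w - two_pi_i * D (G t) w) z h
      (4 * PI * e)).
    assert (B' : Cmod (G s (z + h) - G t (z + h) - (G s z - G t z))
                 <= 4 * PI * e * Cmod h).
    { apply B. intros w Hw.
      assert (HwH : upper_half_plane w) by (apply upper_half_plane_ball with z; lra).
      split.
      - apply is_cderive_minus.
        + exact (HG s 0%nat w HwH).
        + exact (HG t 0%nat w HwH).
      - replace (two_pi_i * D (G s) w - two_pi_i * D (G t) w) with
          (two_pi_i * ((D (G s) w - L w) + - (D (G t) w - L w))) by ring.
        rewrite Cmod_mult, Cmod_two_pi_i.
        assert (Hw2 : Cmod (w - z) < r2) by lra.
        specialize (Hs2 w Hw2). assert (Ht2 := Ht w Hw2).
        assert (T1 := Cmod_triangle (D (G s) w - L w) (- (D (G t) w - L w))).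
        rewrite Cmod_opp in T1. nra. }
    assert (E : z + h - z = h) by ring.
    assert (Hs3 := Hs1 (z + h)). rewrite E in Hs3.
    assert (Hh1 : Cmod h < r1) by lra. specialize (Hs3 Hh1).
    assert (Hz1 : Cmod (z - z) < r1) by lra. specialize (Hs1 z Hz1).
    replace (g (z + h) - g z - (G t (z + h) - G t z)) with
      ((G s (z + h) - G t (z + h) - (G s z - G t z))
       + (- (G s (z + h) - g (z + h)) + (G s z - g z))) by ring.
    eapply Rle_trans; [apply Cmod_triangle|].
    apply Rplus_le_compat; [exact B'|].
    eapply Rle_trans; [apply Cmod_triangle|]. rewrite Cmod_opp. lra. }
  assert (Hd := HG t 0%nat z Hz).
  rewrite is_cderive_eps in Hd. destruct (Hd e He) as [d [Hd0 Hd']].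
  exists (Rmin d r). split; [now apply Rmin_pos|]. intros h Hh.
  assert (H1 := Rlt_le_trans _ _ _ Hh (Rmin_l _ _)).
  assert (H2 := Rlt_le_trans _ _ _ Hh (Rmin_r _ _)).
  specialize (Hd' h H1). specialize (Hinc h H2). simpl in Hd'.
  assert (Hz2 : Cmod (z - z) < r2) by lra. specialize (Ht z Hz2).
  replace (g (z + h) - g z - h * (two_pi_i * L z)) with
    ((g (z + h) - g z - (G t (z + h) - G t z))
     + ((G t (z + h) - G t z - h * (two_pi_i * D (G t) z))
        + h * (two_pi_i * (D (G t) z - L z)))) by ring.
  eapply Rle_trans; [apply Cmod_triangle|].
  eapply Rle_trans; [apply Rplus_le_compat_l, Cmod_triangle|].
  rewrite !Cmod_mult, Cmod_two_pi_i.
  assert (Hh0 := Cmod_ge_0 h).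
  assert (P : Cmod h * (2 * PI * Cmod (D (G t) z - L z)) <= Cmod h * (2 * PI * e)).
  { apply Rmult_le_compat_l; [easy|]. apply Rmult_le_compat_l; lra. }
  replace (eps * Cmod h)%R with (4 * PI * e * Cmod h + (e * Cmod h + Cmod h * (2 * PI * e)))%R
    by (unfold e; field; lra).
  lra.
Qed.

Theorem Weierstrass {T : Type} (F : (T -> Prop) -> Prop)
  {FF : ProperFilter F} (G : T -> C -> C) (g : C -> C) :
  (forall t, smooth (G t)) -> loc_unif F G g ->
  smooth g /\ forall n, loc_unif F (fun t => Dn n (G t)) (Dn n g).
Proof.
  intros HG Hg.
  assert (Hstep : forall n, loc_unif F (fun t => Dn n (G t)) (Dn n g) ->
    (forall z, upper_half_plane z -> is_cderive (Dn n g) z (two_pi_i * Dn (S n) g z)) /\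
    loc_unif F (fun t => Dn (S n) (G t)) (Dn (S n) g)).
  { intros n Hn.
    assert (HGn : forall t, smooth (Dn n (G t))) by (intros t; now apply smooth_Dn).
    destruct (Weierstrass_derivatives_converge F _ _ HGn Hn) as [L HL].
    assert (Hd := is_cderive_limit F _ _ L HGn Hn HL).
    split.
    - intros z Hz. exact (is_cderive_D _ _ _ (Hd z Hz)).
    - apply (loc_unif_ext F (fun t => D (Dn n (G t))) _ L); [easy| |exact HL].
      intros z Hz. symmetry.
      change (D (Dn n g) z = L z). rewrite (D_unique _ _ _ (Hd z Hz)).
      field. apply two_pi_i_neq_0. }
  assert (Hall : forall n, loc_unif F (fun t => Dn n (G t)) (Dn n g)).
  { induction n as [|n IH]; [exact Hg|]. now apply Hstep. }
  split; [|exact Hall]. intros n. now apply Hstep.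
Qed.

(** * Smooth functions and q-series *)

(** It suffices to guess all derivatives at once. *)
Lemma smooth_intro (f : C -> C) (g : nat -> C -> C) :
  (forall z, upper_half_plane z -> f z = g 0%nat z) ->
  (forall n z, upper_half_plane z -> is_cderive (g n) z (two_pi_i * g (S n) z)) ->
  smooth f /\ forall n z, upper_half_plane z -> Dn n f z = g n z.
Proof.
  intros H0 Hg.
  assert (Hstep : forall n, (forall z, upper_half_plane z -> Dn n f z = g n z) ->
    forall z, upper_half_plane z -> is_cderive (Dn n f) z (two_pi_i * g (S n) z)).
  { intros n Hn z Hz. apply is_cderive_ext_ball with (g n) (Im z); [exact Hz| |now apply Hg].
    intros w Hw. symmetry. now apply Hn, upper_half_plane_ball with z. }
  assert (Hall : forall n z, upper_half_plane z -> Dn n f z = g n z).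
  { induction n as [|n IH]; [exact H0|]. intros z Hz.
    change (D (Dn n f) z = g (S n) z).
    rewrite (D_unique _ _ _ (Hstep n IH z Hz)). field. apply two_pi_i_neq_0. }
  split; [|exact Hall]. intros n z Hz. rewrite (Hall (S n) z Hz). exact (Hstep n (Hall n) z Hz).
Qed.

Lemma smooth_plus (f g : C -> C) : smooth f -> smooth g ->
  smooth (fun z => f z + g z) /\
  forall n z, upper_half_plane z -> Dn n (fun z => f z + g z) z = Dn n f z + Dn n g z.
Proof.
  intros Hf Hg.
  apply (smooth_intro _ (fun n z => Dn n f z + Dn n g z)); [easy|].
  intros n z Hz. rewrite Cmult_plus_distr_l.
  apply is_cderive_plus; [now apply Hf|now apply Hg].
Qed.

Lemma smooth_scal (f : C -> C) (c : C) : smooth f -> smooth (fun z => c * f z).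
Proof.
  intros Hf. apply (smooth_intro _ (fun n z => c * Dn n f z)); [easy|].
  intros n z Hz. replace (two_pi_i * (c * Dn (S n) f z)) with
    (c * (two_pi_i * Dn (S n) f z)) by ring.
  apply is_cderive_scal. now apply Hf.
Qed.

Lemma smooth_fin_sum {I : Type} (g : I -> C -> C) (s : list I) :
  (forall i, smooth (g i)) ->
  smooth (fun z => fin_sum (G := C_AbelianGroup) (fun i => g i z) s) /\
  forall n z, upper_half_plane z ->
    Dn n (fun z => fin_sum (G := C_AbelianGroup) (fun i => g i z) s) z
    = fin_sum (G := C_AbelianGroup) (fun i => Dn n (g i) z) s.
Proof.
  intros Hg. induction s as [|i s [IH1 IH2]].
  - apply (smooth_intro (fun _ => 0) (fun _ _ => 0)); [easy|].
    intros n z _. replace (two_pi_i * 0) with (RtoC 0) by ring. apply is_cderive_const.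
  - destruct (smooth_plus _ _ (Hg i) IH1) as [H1 H2]. split; [exact H1|].
    intros n z Hz. refine (eq_trans (H2 n z Hz) _). rewrite IH2 by easy. reflexivity.
Qed.

Lemma smooth_sum_n (g : nat -> C -> C) (N : nat) :
  (forall i, smooth (g i)) -> smooth (fun z => sum_n (G := C_AbelianGroup) (fun i => g i z) N).
Proof.
  intros Hg. induction N as [|N IH].
  - replace (fun z => sum_n (G := C_AbelianGroup) (fun i => g i z) 0) with (g 0%nat); [easy|].
    apply functional_extensionality. intros z. now rewrite sum_O.
  - replace (fun z => sum_n (G := C_AbelianGroup) (fun i => g i z) (S N)) with
      (fun z => sum_n (G := C_AbelianGroup) (fun i => g i z) N + g (S N) z).
    + now apply smooth_plus.
    + apply functional_extensionality. intros z. now rewrite sum_Sn.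
Qed.

Lemma Cexp_plus (z w : C) : Cexp (z + w) = Cexp z * Cexp w.
Proof.
  destruct z as [a b], w as [c d]. unfold Cexp, Re, Im; simpl.
  rewrite exp_plus, cos_plus, sin_plus.
  apply injective_projections; simpl; ring.
Qed.

Lemma Cmod_Cexp (z : C) : Cmod (Cexp z) = exp (Re z).
Proof.
  unfold Cmod, Cexp; simpl.
  replace (exp (Re z) * cos (Im z) * (exp (Re z) * cos (Im z) * 1) +
    exp (Re z) * sin (Im z) * (exp (Re z) * sin (Im z) * 1))%R with
    (exp (Re z) * exp (Re z) * ((sin (Im z))^2 + (cos (Im z))^2))%R by ring.
  generalize (sin2_cos2 (Im z)). rewrite !Rsqr_pow2. intros ->.
  rewrite Rmult_1_r. apply sqrt_square, Rlt_le, exp_pos.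
Qed.

(** The addition theorem reduces the claim to the origin, where it follows from the
    derivatives of [exp], [cos] and [sin] at [0]. *)
Lemma is_cderive_Cexp (z : C) : is_cderive Cexp z (Cexp z).
Proof.
  assert (H : forall eps : R, 0 < eps -> exists d : R, 0 < d /\
    forall h, Cmod h < d -> Cmod (Cexp h - 1 - h) <= eps * Cmod h).
  { intros eps Heps. set (e := Rmin (eps / 6) 1).
    assert (He : 0 < e) by (apply Rmin_pos; lra).
    assert (He1 : e <= eps / 6) by apply Rmin_l. assert (He2 : e <= 1) by apply Rmin_r.
    destruct (is_derive_R_eps_inv exp 0 1) with (eps := e) as [d1 [Hd1 H1]]; [|easy|].
    { evar_last; [apply is_derive_exp|exact exp_0]. }
    destruct (is_derive_R_eps_inv cos 0 0) with (eps := e) as [d2 [Hd2 H2]]; [|easy|].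
    { evar_last; [apply is_derive_cos|rewrite sin_0; exact Ropp_0]. }
    destruct (is_derive_R_eps_inv sin 0 1) with (eps := e) as [d3 [Hd3 H3]]; [|easy|].
    { evar_last; [apply is_derive_sin|exact cos_0]. }
    exists (Rmin (Rmin d1 d2) (Rmin d3 e)). split; [repeat apply Rmin_pos; lra|].
    intros h Hh. destruct h as [x y].
    assert (Hx := re_le_Cmod (x, y)). assert (Hy := im_le_Cmod (x, y)).
    unfold Re, Im in Hx, Hy; simpl in Hx, Hy. set (m := Cmod (x, y)) in *.
    assert (M1 := Rmin_l (Rmin d1 d2) (Rmin d3 e)).
    assert (M2 := Rmin_r (Rmin d1 d2) (Rmin d3 e)).
    assert (M3 := Rmin_l d1 d2). assert (M4 := Rmin_r d1 d2).
    assert (M5 := Rmin_l d3 e). assert (M6 := Rmin_r d3 e).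
    specialize (H1 x ltac:(lra)). specialize (H2 y ltac:(lra)). specialize (H3 y ltac:(lra)).
    rewrite Rplus_0_l in H1, H2, H3. rewrite exp_0 in H1. rewrite cos_0 in H2.
    rewrite sin_0 in H3.
    assert (Hx0 := Rabs_pos x). assert (Hy0 := Rabs_pos y).
    set (u := (cos y, sin y) : C).
    replace (Cexp (x, y) - 1 - (x, y)) with
      ((exp x - 1 - x * 1)%R * u
       + ((1 + x)%R * ((cos y - 1 - y * 0)%R, (sin y - 0 - y * 1)%R) + (0%R, (x * y)%R)))
      by (unfold Cexp, u, Re, Im; apply injective_projections; simpl; ring).
    eapply Rle_trans; [apply Cmod_triangle|].
    eapply Rle_trans; [apply Rplus_le_compat_l, Cmod_triangle|].
    rewrite !Cmod_mult, !Cmod_R.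
    assert (Hu : Cmod u = 1%R).
    { replace u with (Cexp (0%R, y)).
      - rewrite Cmod_Cexp. apply exp_0.
      - unfold u, Cexp, Re, Im; simpl. now rewrite exp_0, !Rmult_1_l. }
    rewrite Hu.
    assert (P2 : Cmod ((cos y - 1 - y * 0)%R, (sin y - 0 - y * 1)%R) <= 2 * e * m).
    { eapply Rle_trans; [apply Cmod_le_Re_Im|]. unfold Re, Im; simpl. nra. }
    assert (P3 : Cmod (0%R, (x * y)%R) <= e * m).
    { eapply Rle_trans; [apply Cmod_le_Re_Im|]. unfold Re, Im; simpl.
      rewrite Rabs_R0, Rabs_mult. nra. }
    assert (P4 : Rabs (1 + x) <= 2).
    { eapply Rle_trans; [apply Rabs_triang|]. rewrite Rabs_R1. lra. }
    assert (P5 : Rabs (1 + x) * Cmod ((cos y - 1 - y * 0)%R, (sin y - 0 - y * 1)%R)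
                 <= 2 * (2 * e * m)).
    { apply Rmult_le_compat; [apply Rabs_pos|apply Cmod_ge_0|easy|easy]. }
    assert (Hm : 0 <= m) by lra.
    assert (P6 : e * m <= eps / 6 * m) by (apply Rmult_le_compat_r; lra).
    assert (P7 : e * Rabs x <= e * m) by (apply Rmult_le_compat_l; lra).
    lra. }
  apply is_cderive_eps. intros eps Heps.
  assert (Hz : 0 < Cmod (Cexp z)) by (rewrite Cmod_Cexp; apply exp_pos).
  destruct (H (eps / Cmod (Cexp z))%R) as [d [Hd0 Hd]]; [now apply Rdiv_lt_0_compat|].
  exists d; split; [easy|]. intros h Hh.
  replace (Cexp (z + h) - Cexp z - h * Cexp z) with (Cexp z * (Cexp h - 1 - h))
    by (rewrite Cexp_plus; ring).
  rewrite Cmod_mult. specialize (Hd h Hh).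
  apply Rle_trans with (Cmod (Cexp z) * (eps / Cmod (Cexp z) * Cmod h))%R.
  - apply Rmult_le_compat_l; lra.
  - right. field. lra.
Qed.

Lemma is_cderive_q (z : C) : is_cderive q z (two_pi_i * q z).
Proof.
  unfold q. rewrite (Cmult_comm two_pi_i).
  apply (is_cderive_comp Cexp (fun tau => 2 * PI * Ci * tau)); [apply is_cderive_Cexp|].
  assert (H := is_cderive_scal _ z 1 two_pi_i (is_cderive_id z)).
  now rewrite Cmult_1_r in H.
Qed.

Lemma is_cderive_q_pow (n : nat) (z : C) :
  is_cderive (fun w => q w ^ n) z (two_pi_i * (INR n * q z ^ n)).
Proof.
  induction n as [|n IH].
  - simpl. replace (two_pi_i * (0 * 1)) with (RtoC 0) by ring. apply is_cderive_const.
  - rewrite S_INR, RtoC_plus, Cpow_S.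
    replace (two_pi_i * ((INR n + 1) * (q z * q z ^ n))) with
      (two_pi_i * q z * q z ^ n + q z * (two_pi_i * (INR n * q z ^ n))) by ring.
    apply (is_cderive_mult q (fun w => q w ^ n)); [apply is_cderive_q|exact IH].
Qed.

Lemma smooth_q_pow (a : C) (n : nat) : smooth (fun z => a * q z ^ n).
Proof.
  apply (smooth_intro _ (fun j z => (INR n ^ j * a) * q z ^ n)).
  - intros z _. simpl. ring.
  - intros j z _.
    replace (two_pi_i * (INR n ^ S j * a * q z ^ n)) with
      ((INR n ^ j * a) * (two_pi_i * (INR n * q z ^ n))) by (rewrite Cpow_S; ring).
    apply (is_cderive_scal (fun z => q z ^ n)), is_cderive_q_pow.
Qed.

Lemma pow_n_Cpow (x : C) (n : nat) : pow_n (K := C_Ring) x n = x ^ n.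
Proof. induction n as [|n IH]; [easy|]. simpl. now rewrite IH. Qed.

Lemma Cmod_q (z : C) : Cmod (q z) = exp (- (2 * PI * Im z)).
Proof.
  unfold q. rewrite Cmod_Cexp. f_equal. destruct z; unfold Re, Im; simpl. ring.
Qed.

(** The power series converges geometrically on a disc around [z], because it converges at
    a point below the disc, where [q] is larger in modulus. *)
Lemma q_series_smooth (a : nat -> C) (phi : C -> C) :
  has_q_expansion a phi -> smooth phi.
Proof.
  intros H.
  set (P := (fun N w => sum_n (G := C_AbelianGroup) (fun n => a n * q w ^ n) N)
    : nat -> C -> C).
  assert (HS : forall w, upper_half_plane w -> forall eps : R, 0 < eps ->
    eventually (fun N => Cmod (P N w - phi w) < eps)).
  { intros w Hw. apply (filterlim_C_iff eventually (fun N => P N w)).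
    apply filterlim_ext with (2 := H w Hw). intros N. unfold P.
    apply (sum_n_ext (G := C_AbelianGroup)). intros n. unfold scal; simpl.
    rewrite pow_n_Cpow. apply Cmult_comm. }
  apply (Weierstrass eventually P phi).
  { intros N. apply smooth_sum_n. intros n. apply smooth_q_pow. }
  intros z Hz. set (y := Im z). assert (Hy : 0 < y) by exact Hz.
  assert (HPI := PI_RGT_0).
  exists (y / 2)%R. split; [lra|].
  set (rho := exp (- (PI * y / 2))).
  assert (Hrho : 0 < rho < 1).
  { split; [apply exp_pos|]. rewrite <- exp_0. apply exp_increasing.
    assert (0 < PI * y) by now apply Rmult_lt_0_compat. lra. }
  (* Convergence at [z1], below the disc, controls the coefficients. *)
  set (z1 := (0%R, (y / 4)%R) : C).
  assert (Hq1 : Cmod (q z1) = rho).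
  { rewrite Cmod_q. unfold rho, z1, Im; simpl. f_equal. field. }
  (* Two consecutive partial sums lie within [1] of their limit. *)
  assert (Hcoef : exists N0, forall n, (N0 <= n)%nat -> Cmod (a n) * rho ^ n <= 2).
  { destruct (HS z1) with (eps := 1%R) as [N HN]; [unfold upper_half_plane, z1, Im; simpl; lra|lra|].
    exists (1 + N)%nat. intros n Hn. destruct n as [|n]; [lia|].
    assert (H1 := HN n ltac:(lia)). assert (H2 := HN (S n) ltac:(lia)).
    rewrite <- Hq1, <- Cmod_pow, <- Cmod_mult.
    replace (a (S n) * q z1 ^ S n) with ((P (S n) z1 - phi z1) + - (P n z1 - phi z1)).
    - eapply Rle_trans; [apply Cmod_triangle|]. rewrite Cmod_opp. lra.
    - unfold P. rewrite sum_Sn. unfold plus; simpl. ring. }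
  destruct Hcoef as [N0 HN0].
  intros eps Heps.
  destruct (pow_lt_1_zero rho) with (y := (eps * (1 - rho) / 4)%R) as [N1 HN1].
  { rewrite Rabs_pos_eq; lra. }
  { assert (0 < eps * (1 - rho)) by (apply Rmult_lt_0_compat; lra). lra. }
  exists (N0 + N1)%nat. intros N HN w Hw.
  assert (HwH : upper_half_plane w) by (apply upper_half_plane_ball with z; unfold y in *; lra).
  assert (Hqw : Cmod (q w) <= rho * rho).
  { rewrite Cmod_q. unfold rho. rewrite <- exp_plus.
    assert (E : - (2 * PI * Im w) <= - (PI * y / 2) + - (PI * y / 2)).
    { generalize (im_le_Cmod (w - z)) (Rle_abs (- Im (w - z))). rewrite Rabs_Ropp.
      replace (Im (w - z)) with (Im w - y)%R by (unfold y, Im; simpl; ring).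
      intros. assert (y / 2 <= Im w) by lra. nra. }
    destruct E as [E|E]; [left; now apply exp_increasing|right; now f_equal]. }
  assert (Hterm : forall n, (N0 <= n)%nat -> Cmod (a n * q w ^ n) <= 2 * rho ^ n).
  { intros n Hn. rewrite Cmod_mult, Cmod_pow.
    apply Rle_trans with (Cmod (a n) * (rho ^ n * rho ^ n))%R.
    - apply Rmult_le_compat_l; [apply Cmod_ge_0|]. rewrite <- Rpow_mult_distr.
      apply pow_incr. split; [apply Cmod_ge_0|easy].
    - rewrite <- Rmult_assoc. apply Rmult_le_compat_r; [apply pow_le; lra|]. now apply HN0. }
  assert (Htail : forall k, Cmod (P (k + N)%nat w - P N w)
                            <= 2 * (rho ^ N - rho ^ (k + N)) / (1 - rho)).
  { induction k as [|k IH].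
    - simpl. replace (P N w - P N w) with (RtoC 0) by ring. rewrite Cmod_0. right. field. lra.
    - assert (E : P (1 + k + N)%nat w = P (k + N)%nat w + a (1 + k + N)%nat * q w ^ (1 + k + N)).
      { unfold P. simpl (1 + k + N)%nat. now rewrite sum_Sn. }
      change (S k + N)%nat with (1 + k + N)%nat. rewrite E.
      replace (P (k + N)%nat w + a (1 + k + N)%nat * q w ^ (1 + k + N) - P N w) with
        ((P (k + N)%nat w - P N w) + a (1 + k + N)%nat * q w ^ (1 + k + N)) by ring.
      eapply Rle_trans; [apply Cmod_triangle|].
      assert (Ht := Hterm (1 + k + N)%nat ltac:(lia)).
      apply Rle_trans with (2 * (rho ^ N - rho ^ (k + N)) / (1 - rho) + 2 * rho ^ (k + N))%R.
      + assert (Hp : 0 < rho ^ (k + N)) by (apply pow_lt; lra).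
        assert (rho ^ (1 + k + N) <= rho ^ (k + N)) by (simpl; nra). lra.
      + right. simpl. field. lra. }
  apply Rle_lt_trans with (2 * rho ^ N / (1 - rho))%R.
  - apply Rle_plus_epsilon. intros d Hd.
    destruct (HS w HwH d Hd) as [k Hk]. specialize (Hk (k + N)%nat ltac:(lia)).
    replace (P N w - phi w) with (- (P (k + N)%nat w - P N w) + (P (k + N)%nat w - phi w)) by ring.
    eapply Rle_trans; [apply Cmod_triangle|]. rewrite Cmod_opp.
    apply Rplus_le_compat; [|lra]. eapply Rle_trans; [apply Htail|].
    unfold Rdiv. apply Rmult_le_compat_r; [apply Rlt_le, Rinv_0_lt_compat; lra|].
    assert (Hp : 0 < rho ^ (k + N)) by (apply pow_lt; lra). lra.
  - specialize (HN1 N ltac:(lia)). rewrite Rabs_pos_eq in HN1 by (apply pow_le; lra).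
    apply Rmult_lt_reg_r with (1 - rho)%R; [lra|].
    unfold Rdiv. rewrite Rmult_assoc, Rinv_l, Rmult_1_r by lra.
    assert (Hp : 0 < rho ^ N) by (apply pow_lt; lra). lra.
Qed.

(** * Derivatives of slashed functions *)

Lemma falling_add (x : Z) (i j : nat) :
  falling x (i + j) = (falling x i * falling (x - Z.of_nat i) j)%Z.
Proof.
  induction j as [|j IH].
  - rewrite Nat.add_0_r. simpl. ring.
  - rewrite Nat.add_succ_r. simpl. rewrite IH, Nat2Z.inj_add. ring.
Qed.

Lemma sum_n_shift (u : nat -> C) (n : nat) :
  sum_n (G := C_AbelianGroup) u (S n) =
  u 0%nat + sum_n (G := C_AbelianGroup) (fun p => u (S p)) n.
Proof.
  induction n as [|n IH].
  - rewrite sum_Sn, !sum_O. reflexivity.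
  - rewrite sum_Sn, IH, sum_Sn. unfold plus; simpl. ring.
Qed.

Lemma sum_n_plus_C (u v : nat -> C) (n : nat) :
  sum_n (G := C_AbelianGroup) (fun p => u p + v p) n =
  sum_n (G := C_AbelianGroup) u n + sum_n (G := C_AbelianGroup) v n.
Proof. exact (sum_n_plus (G := C_AbelianGroup) u v n). Qed.

Lemma sum_n_scal_C (c : C) (u : nat -> C) (n : nat) :
  sum_n (G := C_AbelianGroup) (fun p => c * u p) n =
  c * sum_n (G := C_AbelianGroup) u n.
Proof. exact (sum_n_mult_l (K := C_Ring) c u n). Qed.

Lemma is_cderive_sum_n (f : nat -> C -> C) (l : nat -> C) (n : nat) (z : C) :
  (forall p, (p <= n)%nat -> is_cderive (f p) z (l p)) ->
  is_cderive (fun w => sum_n (G := C_AbelianGroup) (fun p => f p w) n) z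
    (sum_n (G := C_AbelianGroup) l n).
Proof. exact (is_derive_sum_n (K := C_AbsRing) (V := C_NormedModule) f n z l). Qed.

(** The number [binomial n p * (k + p) (k + p + 1) ... (k + n - 1)], written in terms of the
    binomial coefficients of the Rankin-Cohen brackets.  Its extension by zero to [p > n]
    makes the recurrence [lift_coef_succ] hold up to the last index. *)
Definition lift_coef (k : Z) (n p : nat) : R :=
  if (p <=? n)%nat
  then (INR (fact n) / INR (fact p) * gbinom (k + Z.of_nat n - 1) (n - p))%R else 0%R.

Lemma falling_succ_l (x : Z) (j : nat) : falling x (S j) = (x * falling (x - 1) j)%Z.
Proof.
  change (S j) with (1 + j)%nat. rewrite falling_add.
  change (falling x 1) with (1 * (x - 0))%Z. change (Z.of_nat 1) with 1%Z. ring.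
Qed.

Lemma lift_coef_succ_0 (k : Z) (n : nat) :
  lift_coef k (S n) 0 = ((INR n + IZR k) * lift_coef k n 0)%R.
Proof.
  unfold lift_coef, gbinom. rewrite !Nat.sub_0_r. simpl (0 <=? _)%nat. cbv iota.
  replace (k + Z.of_nat (S n) - 1)%Z with (k + Z.of_nat n)%Z by lia.
  rewrite falling_succ_l, mult_IZR, plus_IZR, <- INR_IZR_INZ.
  assert (F := INR_fact_neq_0). field. auto.
Qed.

Lemma lift_coef_succ (k : Z) (n p : nat) : (p <= n)%nat ->
  lift_coef k (S n) (S p) =
  ((INR n + IZR k + INR (S p)) * lift_coef k n (S p) + lift_coef k n p)%R.
Proof.
  intros Hp. unfold lift_coef, gbinom.
  rewrite (proj2 (Nat.leb_le p n) Hp).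
  replace (S p <=? S n)%nat with true by (symmetry; apply Nat.leb_le; lia).
  simpl (S n - S p)%nat.
  replace (k + Z.of_nat (S n) - 1)%Z with (k + Z.of_nat n)%Z by lia.
  assert (F := INR_fact_neq_0).
  destruct (Nat.leb_spec (S p) n) as [H|H].
  - destruct (Nat.le_exists_sub (S p) n H) as [m [Hm _]].
    replace (n - p)%nat with (S m) by lia. replace (n - S p)%nat with m by lia.
    rewrite (falling_succ_l (k + Z.of_nat n) m).
    simpl (falling _ (S m)).
    rewrite !mult_IZR, (fact_simpl n), (fact_simpl m), (fact_simpl p), !mult_INR.
    rewrite !minus_IZR, !plus_IZR, <- !INR_IZR_INZ, !S_INR.
    replace (INR n) with (INR m + (INR p + 1))%R
      by (rewrite Hm, plus_INR, S_INR; ring).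
    assert (INR m + 1 <> 0)%R by (rewrite <- S_INR; apply not_0_INR; lia).
    assert (INR p + 1 <> 0)%R by (rewrite <- S_INR; apply not_0_INR; lia).
    field. repeat split; auto.
  - assert (p = n) as -> by lia. rewrite Nat.sub_diag. simpl falling.
    rewrite Rmult_0_r, Rplus_0_l. field. repeat split; auto.
Qed.

Lemma CpowZ_succ (z : C) (n : Z) : z <> 0 -> CpowZ z (n + 1) = z * CpowZ z n.
Proof.
  intros Hz. assert (Hp : forall m, z ^ m <> 0) by (intros; now apply Cpow_nz).
  destruct n as [|p|p].
  - simpl. ring.
  - simpl (Z.pos p + 1)%Z. unfold CpowZ. rewrite Pos2Nat.inj_add, Nat.add_comm. reflexivity.
  - destruct (Pos.eq_dec p 1) as [->|Hp1].
    + simpl. field. easy.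
    + replace (Z.neg p + 1)%Z with (Z.neg (p - 1)) by lia. unfold CpowZ.
      replace (Pos.to_nat p) with (S (Pos.to_nat (p - 1))) by lia.
      rewrite Cpow_S. field. now split.
Qed.

Lemma CpowZ_add (z : C) (m n : Z) : z <> 0 -> CpowZ z (m + n) = CpowZ z m * CpowZ z n.
Proof.
  intros Hz. revert n. apply Z.peano_ind.
  - rewrite Z.add_0_r. simpl. ring.
  - intros n IH. unfold Z.succ. rewrite Z.add_assoc, !CpowZ_succ, IH by easy. ring.
  - intros n IH.
    assert (E1 := CpowZ_succ z (m + Z.pred n) Hz). assert (E2 := CpowZ_succ z (Z.pred n) Hz).
    replace (m + Z.pred n + 1)%Z with (m + n)%Z in E1 by lia.
    replace (Z.pred n + 1)%Z with n in E2 by lia.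
    rewrite E2, E1 in IH.
    assert (E : forall x y : C, z * x = z * y -> x = y).
    { intros x y H. replace x with (/ z * (z * x)) by (field; easy). rewrite H. field. easy. }
    apply E. rewrite IH. ring.
Qed.

Lemma is_cderive_eq (f : C -> C) (z l l' : C) : is_cderive f z l -> l = l' -> is_cderive f z l'.
Proof. now intros H <-. Qed.

Lemma is_cderive_pow (n : nat) (z : C) : is_cderive (fun w => w ^ S n) z (INR (S n) * z ^ n).
Proof.
  induction n as [|n IH].
  - apply is_cderive_eq with (RtoC 1); [|simpl; ring].
    apply (is_cderive_ext_ball (fun w => w) _ z 1 1 Rlt_0_1); [|apply is_cderive_id].
    intros w _. simpl. ring.
  - apply is_cderive_eq with (1 * z ^ S n + z * (INR (S n) * z ^ n)).
    + exact (is_cderive_mult (fun w => w) _ z _ _ (is_cderive_id z) IH).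
    + rewrite (S_INR (S n)), RtoC_plus, Cpow_S. ring.
Qed.

Lemma is_cderive_CpowZ (n : Z) (z : C) : z <> 0 ->
  is_cderive (fun w => CpowZ w n) z (IZR n * CpowZ z (n - 1)).
Proof.
  intros Hz. destruct n as [|p|p].
  - apply is_cderive_eq with (RtoC 0); [exact (is_cderive_const 1 z)|ring].
  - unfold CpowZ at 1. destruct (Pos2Nat.is_succ p) as [m Hm]. rewrite Hm.
    apply is_cderive_eq with (INR (S m) * z ^ m); [apply is_cderive_pow|].
    rewrite INR_IZR_INZ. rewrite <- Hm, positive_nat_Z. f_equal.
    replace (Z.pos p - 1)%Z with (Z.of_nat m) by lia.
    destruct m as [|m]; [easy|]. simpl Z.of_nat. unfold CpowZ.
    now rewrite SuccNat2Pos.id_succ.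
  - unfold CpowZ at 1. destruct (Pos2Nat.is_succ p) as [m Hm].
    assert (Hm' : z ^ m <> 0) by now apply Cpow_nz.
    replace (Z.neg p - 1)%Z with (Z.neg (p + 1)) by lia. unfold CpowZ.
    rewrite Pos2Nat.inj_add, Hm. change (Pos.to_nat 1) with 1%nat.
    apply is_cderive_eq with (- / (z ^ S m * z ^ S m) * (INR (S m) * z ^ m)).
    + apply (is_cderive_comp Cinv (fun w => w ^ S m)); [|apply is_cderive_pow].
      apply is_cderive_inv. now apply Cpow_nz.
    + rewrite INR_IZR_INZ. rewrite <- Hm, positive_nat_Z, Hm.
      replace (IZR (Z.neg p)) with (- IZR (Z.pos p))%R by (rewrite <- opp_IZR; easy).
      rewrite RtoC_opp, Nat.add_1_r, !Cpow_S. field. now split.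
Qed.

Definition aut_factor (M : SL2Z) (z : C) : C := IZR (mc M) * z + IZR (md M).

Definition moebius (M : SL2Z) (z : C) : C :=
  (IZR (ma M) * z + IZR (mb M)) / aut_factor M z.

Lemma SL2Z_det_R (M : SL2Z) :
  (IZR (ma M) * IZR (md M) - IZR (mb M) * IZR (mc M))%R = 1%R.
Proof. now rewrite <- !mult_IZR, <- minus_IZR, SL2Z_det. Qed.

Lemma aut_factor_neq_0 (M : SL2Z) (z : C) : upper_half_plane z -> aut_factor M z <> 0.
Proof.
  unfold upper_half_plane, aut_factor. destruct z as [x y]. intros Hz E.
  unfold Im in Hz; simpl in Hz. injection E as E1 E2.
  assert (Hc : IZR (mc M) = 0%R).
  { apply Rmult_eq_reg_r with y; [|lra]. lra. }
  assert (D := SL2Z_det_R M). rewrite Hc in E1, D.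
  assert (Hd : IZR (md M) = 0%R) by lra. rewrite Hd in D. lra.
Qed.

(** The imaginary part of [moebius M z] is that of [z] divided by the squared modulus of
    [c z + d]. *)
Lemma moebius_upper_half_plane (M : SL2Z) (z : C) :
  upper_half_plane z -> upper_half_plane (moebius M z).
Proof.
  intros Hz. assert (HJ := aut_factor_neq_0 M z Hz).
  assert (Hn := proj1 (Cmod_gt_0 _) HJ).
  unfold upper_half_plane.
  assert (E : (Im (moebius M z) * Cmod (aut_factor M z) ^ 2)%R = Im z).
  { replace (Im (moebius M z)) with
      ((Im ((IZR (ma M) * z + IZR (mb M)) * Cconj (aut_factor M z))
        / Cmod (aut_factor M z) ^ 2)%R).
    - replace (Im z) with ((IZR (ma M) * IZR (md M) - IZR (mb M) * IZR (mc M)) * Im z)%R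
        by (rewrite SL2Z_det_R; ring).
      unfold aut_factor, Im, Cconj at 1; simpl. field. apply Rgt_not_eq, Hn.
    - unfold moebius, Cdiv, Cinv. rewrite Cmod2_alt. unfold Re, Im, Cconj; simpl. field.
      intros E. apply HJ. destruct (Rplus_sqr_eq_0 _ _ E) as [E1 E2].
      apply injective_projections; unfold aut_factor; simpl; lra. }
  assert (Hp : 0 < Cmod (aut_factor M z) ^ 2) by now apply pow_lt.
  unfold upper_half_plane in Hz. rewrite <- E in Hz. apply Rmult_lt_reg_r with (1 := Hp). rewrite Rmult_0_l. exact Hz.
Qed.

Lemma is_cderive_aut_factor (M : SL2Z) (z : C) : is_cderive (aut_factor M) z (IZR (mc M)).
Proof.
  apply is_cderive_eq with (IZR (mc M) * 1 + 0); [|ring].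
  apply (is_cderive_plus (fun w => IZR (mc M) * w) (fun _ => RtoC (IZR (md M))));
    [apply is_cderive_scal, is_cderive_id|apply is_cderive_const].
Qed.

Lemma is_cderive_moebius (M : SL2Z) (z : C) : upper_half_plane z ->
  is_cderive (moebius M) z (/ (aut_factor M z * aut_factor M z)).
Proof.
  intros Hz. assert (HJ := aut_factor_neq_0 M z Hz).
  assert (H : is_cderive (fun w => IZR (ma M) * w + IZR (mb M)) z (IZR (ma M) * 1 + 0)).
  { apply (is_cderive_plus (fun w => IZR (ma M) * w) (fun _ => RtoC (IZR (mb M))));
    [apply is_cderive_scal, is_cderive_id|apply is_cderive_const]. }
  eapply is_cderive_eq.
  - eapply (is_cderive_mult _ (fun w => / aut_factor M w) z); [exact H|].
    apply (is_cderive_comp Cinv (aut_factor M)); [now apply is_cderive_inv|].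
    apply is_cderive_aut_factor.
  - assert (D := SL2Z_det_R M). apply (f_equal RtoC) in D.
    rewrite RtoC_minus, !RtoC_mult in D.
    transitivity ((IZR (ma M) * IZR (md M) - IZR (mb M) * IZR (mc M))
      / (aut_factor M z * aut_factor M z)); [|rewrite D; field; easy].
    unfold aut_factor in *. field. easy.
Qed.

(** The function [- c / (2 pi i (c z + d))]; its powers measure the failure of modularity of
    the derivatives of a modular form.  It satisfies the Riccati equation [D y = y ^ 2]. *)
Definition aut_twist (M : SL2Z) (z : C) : C :=
  - (IZR (mc M) / (two_pi_i * aut_factor M z)).

Lemma is_cderive_aut_twist (M : SL2Z) (z : C) : upper_half_plane z ->
  is_cderive (aut_twist M) z (two_pi_i * aut_twist M z ^ 2).
Proof.
  intros Hz. assert (HJ := aut_factor_neq_0 M z Hz). assert (H2 := two_pi_i_neq_0).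
  apply is_cderive_ext_ball with (fun w => - (IZR (mc M) / two_pi_i) * / aut_factor M w) (Im z).
  - exact Hz.
  - intros w Hw. apply upper_half_plane_ball in Hw.
    assert (HJw := aut_factor_neq_0 M w Hw). unfold aut_twist. field. now split.
  - eapply is_cderive_eq.
    + apply (is_cderive_scal (fun w => / aut_factor M w)).
      apply (is_cderive_comp Cinv (aut_factor M)); [now apply is_cderive_inv|].
      apply is_cderive_aut_factor.
    + unfold aut_twist. simpl. field. now split.
Qed.

Lemma is_cderive_aut_twist_pow (M : SL2Z) (n : nat) (z : C) : upper_half_plane z ->
  is_cderive (fun w => aut_twist M w ^ n) z (two_pi_i * (INR n * aut_twist M z ^ S n)).
Proof.
  intros Hz. destruct n as [|n].
  - apply is_cderive_eq with (RtoC 0); [exact (is_cderive_const 1 z)|simpl; ring].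
  - eapply is_cderive_eq.
    + apply (is_cderive_comp (fun w => w ^ S n) (aut_twist M)); [apply is_cderive_pow|].
      now apply is_cderive_aut_twist.
    + rewrite !Cpow_S. ring.
Qed.

Definition slash_Dn (k : Z) (M : SL2Z) (g : C -> C) (p : nat) : C -> C :=
  slash (k + 2 * Z.of_nat p) (Dn p g) M.

(** One derivative raises the weight by two, because the derivative of [moebius M] is
    [(c z + d) ^ (- 2)]; differentiating the factor of automorphy gives the second term. *)
Lemma is_cderive_slash_Dn (k : Z) (M : SL2Z) (g : C -> C) (p : nat) (z : C) :
  smooth g -> upper_half_plane z ->
  is_cderive (slash_Dn k M g p) z
    (two_pi_i * (slash_Dn k M g (S p) z
                 + (IZR k + 2 * INR p) * aut_twist M z * slash_Dn k M g p z)).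
Proof.
  intros Hg Hz. assert (HJ := aut_factor_neq_0 M z Hz). assert (H2 := two_pi_i_neq_0).
  eapply is_cderive_eq.
  - apply (is_cderive_mult (fun w => CpowZ (aut_factor M w) (- (k + 2 * Z.of_nat p)))
      (fun w => Dn p g (moebius M w))).
    + apply (is_cderive_comp (fun w => CpowZ w (- (k + 2 * Z.of_nat p))) (aut_factor M));
        [now apply is_cderive_CpowZ|apply is_cderive_aut_factor].
    + apply (is_cderive_comp (Dn p g) (moebius M)); [|now apply is_cderive_moebius].
      apply Hg. now apply moebius_upper_half_plane.
  - unfold slash_Dn, slash. fold (aut_factor M z). fold (moebius M z).
    set (m := (- (k + 2 * Z.of_nat p))%Z).
    replace (- (k + 2 * Z.of_nat (S p)))%Z with (m - 1 - 1)%Z by (unfold m; lia).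
    assert (E1 := CpowZ_succ (aut_factor M z) (m - 1) HJ).
    assert (E2 := CpowZ_succ (aut_factor M z) (m - 1 - 1) HJ).
    replace (m - 1 - 1 + 1)%Z with (m - 1)%Z in E2 by ring.
    replace (m - 1 + 1)%Z with m in E1 by ring.
    rewrite E1, E2.
    assert (Em : RtoC (IZR m) = - (IZR k + 2 * INR p)).
    { unfold m. rewrite opp_IZR, plus_IZR, mult_IZR, <- INR_IZR_INZ.
      now rewrite RtoC_opp, RtoC_plus, RtoC_mult. }
    rewrite Em. unfold aut_twist. change (Dn (S p) g) with (D (Dn p g)).
    field. now split.
Qed.

(** Induction on [n]: by [is_cderive_slash_Dn] and [D y = y ^ 2], differentiating the sum
    for [n] turns the coefficient of index [p] into [n + k + p] times itself and adds it to
    that of index [p + 1], which is the recurrence of [lift_coef]. *)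
Lemma slash_smooth (k : Z) (M : SL2Z) (g : C -> C) : smooth g ->
  smooth (slash k g M) /\
  forall n z, upper_half_plane z ->
    Dn n (slash k g M) z =
    sum_n (G := C_AbelianGroup)
      (fun p => lift_coef k n p * aut_twist M z ^ (n - p) * slash_Dn k M g p z) n.
Proof.
  intros Hg.
  apply (smooth_intro _ (fun n z => sum_n (G := C_AbelianGroup)
      (fun p => lift_coef k n p * aut_twist M z ^ (n - p) * slash_Dn k M g p z) n)).
  - intros z _. rewrite sum_O. unfold lift_coef, slash_Dn, gbinom; simpl.
    rewrite Z.add_0_r. replace (1 / 1 * (1 / 1))%R with 1%R by field. ring.
  - intros n z Hz. set (Y := aut_twist M z). set (F := fun p => slash_Dn k M g p z).
    set (u := fun p => (INR n + IZR k + INR p) * lift_coef k n p * Y ^ (S n - p) * F p).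
    set (v := fun p => lift_coef k n p * Y ^ (n - p) * F (S p)).
    (* This term is added so that the sum of [u] has the range of the sum for [S n]. *)
    assert (Hu0 : u (S n) = 0).
    { unfold u, lift_coef. rewrite (proj2 (Nat.leb_gt (S n) n)) by lia. ring. }
    apply is_cderive_eq with
      (sum_n (G := C_AbelianGroup) (fun p => two_pi_i * (u p + v p)) n).
    + apply (is_cderive_sum_n
        (fun p z => lift_coef k n p * aut_twist M z ^ (n - p) * slash_Dn k M g p z)).
      intros p Hp. eapply is_cderive_eq.
      * apply (is_cderive_mult (fun z => lift_coef k n p * aut_twist M z ^ (n - p))
          (slash_Dn k M g p)).
        -- apply (is_cderive_scal (fun z => aut_twist M z ^ (n - p))).
           now apply is_cderive_aut_twist_pow.
        -- now apply is_cderive_slash_Dn.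
      * fold Y. fold (F p). fold (F (S p)). unfold u, v.
        replace (S n - p)%nat with (S (n - p)) by lia. rewrite !Cpow_S.
        rewrite (minus_INR n p Hp), RtoC_minus. ring.
    + rewrite sum_n_scal_C, sum_n_plus_C. f_equal.
      rewrite sum_n_shift.
      transitivity (sum_n (G := C_AbelianGroup) u (S n) + sum_n (G := C_AbelianGroup) v n).
      { rewrite sum_Sn, Hu0. unfold plus; simpl. now rewrite Cplus_0_r. }
      rewrite sum_n_shift, <- Cplus_assoc, <- sum_n_plus_C. f_equal.
      * unfold u. rewrite lift_coef_succ_0, RtoC_mult, RtoC_plus. simpl (INR 0).
        fold Y. fold (F 0%nat). ring.
      * apply (sum_n_ext_loc (G := C_AbelianGroup)). intros p Hp. unfold u, v.
        rewrite lift_coef_succ by easy. rewrite RtoC_plus, RtoC_mult, !RtoC_plus.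
        simpl (S n - S p)%nat. fold Y. fold (F (S p)).
        eq_in_C. ring.
Qed.

(** * Equivariance of Rankin-Cohen brackets *)

(** The Appell polynomials with values [A j] at [0]: [appell A (S j)] is the antiderivative of
    [appell A j] with value [A (S j)] at [0]. *)
Definition appell (A : nat -> C) (j : nat) (y : C) : C :=
  sum_n (G := C_AbelianGroup) (fun p => RtoC (/ INR (fact (j - p))) * y ^ (j - p) * A p) j.

Lemma appell_succ (A : nat -> C) (j : nat) (y : C) :
  appell A (S j) y =
  sum_n (G := C_AbelianGroup)
    (fun p => RtoC (/ INR (fact (S (j - p)))) * y ^ S (j - p) * A p) j + A (S j).
Proof.
  unfold appell. rewrite sum_Sn. apply (f_equal2 Cplus).
  - apply (sum_n_ext_loc (G := C_AbelianGroup)). intros p Hp.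
    now replace (S j - p)%nat with (S (j - p)) by lia.
  - rewrite Nat.sub_diag. simpl. rewrite Rinv_1. ring.
Qed.

Lemma is_cderive_appell (A : nat -> C) (j : nat) (y : C) :
  is_cderive (appell A (S j)) y (appell A j y).
Proof.
  apply is_cderive_ext_ball with (r := 1%R) (f := fun y =>
    sum_n (G := C_AbelianGroup)
      (fun p => RtoC (/ INR (fact (S (j - p)))) * y ^ S (j - p) * A p) j + A (S j)).
  - lra.
  - intros w _. symmetry. apply appell_succ.
  - apply is_cderive_eq with (appell A j y + 0); [|ring].
    apply is_cderive_plus; [|apply is_cderive_const].
    apply (is_cderive_sum_n
      (fun p y => RtoC (/ INR (fact (S (j - p)))) * y ^ S (j - p) * A p)).
    intros p Hp. eapply is_cderive_eq.
    + apply (is_cderive_mult (fun y => RtoC (/ INR (fact (S (j - p)))) * y ^ S (j - p))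
        (fun _ => A p)); [|apply is_cderive_const].
      apply (is_cderive_scal (fun y => y ^ S (j - p))), is_cderive_pow.
    + rewrite fact_simpl, mult_INR.
      assert (H1 : INR (S (j - p)) <> 0) by (apply not_0_INR; lia).
      assert (H2 := INR_fact_neq_0 (j - p)).
      rewrite Rinv_mult, !RtoC_mult, !RtoC_inv by easy.
      assert (H1' : RtoC (INR (S (j - p))) <> 0) by (intros E; apply H1; now injection E).
      assert (H2' : RtoC (INR (fact (j - p))) <> 0) by (intros E; apply H2; now injection E).
      field. now split.
Qed.

Lemma appell_0 (A : nat -> C) (y : C) : appell A 0 y = A 0%nat.
Proof. unfold appell. rewrite sum_O. simpl. rewrite Rinv_1. ring. Qed.

Lemma appell_at_0 (A : nat -> C) (j : nat) : appell A j 0 = A j.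
Proof.
  destruct j as [|j]; [apply appell_0|]. rewrite appell_succ.
  rewrite (sum_n_ext (G := C_AbelianGroup) _ (fun p => 0 * RtoC 0)).
  - rewrite sum_n_scal_C. ring.
  - intros p. rewrite Cpow_S. eq_in_C. ring.
Qed.

(** The left-hand side is constant in [y]: the two halves of its derivative cancel
    because differentiation shifts the index of either factor. *)
Lemma appell_convolution (A B : nat -> C) (n : nat) (y : C) :
  sum_n (G := C_AbelianGroup) (fun j => (-1) ^ j * (appell A j y * appell B (n - j) y)) n =
  sum_n (G := C_AbelianGroup) (fun j => (-1) ^ j * (A j * B (n - j)%nat)) n.
Proof.
  set (G := (fun y => sum_n (G := C_AbelianGroup)
    (fun j => (-1) ^ j * (appell A j y * appell B (n - j) y)) n) : C -> C).
  set (d := fun (A : nat -> C) j y => match j with O => RtoC 0 | S j => appell A j y end).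
  assert (Hd : forall A j y, is_cderive (appell A j) y (d A j y)).
  { intros A0 [|j] y0; [|apply is_cderive_appell].
    apply is_cderive_ext_ball with (fun _ => A0 0%nat) 1%R; [lra| |apply is_cderive_const].
    intros w _. now rewrite appell_0. }
  assert (HG : forall y, is_cderive G y 0).
  { intros y0. eapply is_cderive_eq.
    - apply (is_cderive_sum_n (fun j y => (-1) ^ j * (appell A j y * appell B (n - j) y))).
      intros j _. apply is_cderive_scal. apply (is_cderive_mult (appell A j) (appell B (n - j)));
      apply Hd.
    - (* The sum telescopes; these are its partial sums. *)
      assert (H : forall m, (m <= n)%nat -> sum_n (G := C_AbelianGroup) (fun j => (-1) ^ j *
        (d A j y0 * appell B (n - j) y0 + appell A j y0 * d B (n - j)%nat y0)) m
        = (-1) ^ m * (appell A m y0 * d B (n - m)%nat y0)).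
      { induction m as [|m IH]; intros Hm.
        - rewrite sum_O. simpl. ring.
        - rewrite sum_Sn, IH by lia. replace (n - m)%nat with (S (n - S m)) by lia.
          unfold plus; simpl. ring. }
      rewrite H by lia. rewrite Nat.sub_diag. simpl. ring. }
  change (G y = sum_n (G := C_AbelianGroup) (fun j => (-1) ^ j * (A j * B (n - j)%nat)) n).
  transitivity (G 0).
  - assert (H := cderive_bound_increment G (fun _ => RtoC 0) 0 y 0).
    rewrite Cplus_0_l, Rmult_0_l in H.
    assert (E : G y - G 0 = 0).
    { apply Cmod_eq_0, Rle_antisym; [|apply Cmod_ge_0]. apply H.
      intros w _. split; [apply HG|rewrite Cmod_0; lra]. }
    replace (G y) with ((G y - G 0) + G 0) by ring. rewrite E. ring.
  - unfold G. apply (sum_n_ext (G := C_AbelianGroup)). intros j. now rewrite !appell_at_0.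
Qed.

(** The normalization on the left is one of the two factors into which the coefficient of
    a Rankin-Cohen bracket of order [n] splits.  It completes the products in [lift_coef], which end at
    [k + j - 1], to products ending at [k + n - 1]; after that the coefficients do not
    depend on [j] any more, and no division by [k] is needed. *)
Lemma lift_coef_appell (k : Z) (n j : nat) (F : nat -> C) (y : C) : (j <= n)%nat ->
  RtoC (IZR (falling (k + Z.of_nat n - 1) (n - j)) / INR (fact j)) *
    sum_n (G := C_AbelianGroup) (fun p => lift_coef k j p * y ^ (j - p) * F p) j =
  appell (fun p => RtoC (IZR (falling (k + Z.of_nat n - 1) (n - p)) / INR (fact p)) * F p) j y.
Proof.
  intros Hj. unfold appell. rewrite <- sum_n_scal_C.
  apply (sum_n_ext_loc (G := C_AbelianGroup)). intros p Hp.
  eq_in_C.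
  replace (n - p)%nat with ((n - j) + (j - p))%nat by lia.
  rewrite falling_add, mult_IZR.
  replace (k + Z.of_nat n - 1 - Z.of_nat (n - j))%Z with (k + Z.of_nat j - 1)%Z by lia.
  unfold lift_coef, gbinom. rewrite (proj2 (Nat.leb_le p j) Hp).
  set (a := IZR (falling (k + Z.of_nat n - 1) (n - j))).
  set (b := IZR (falling (k + Z.of_nat j - 1) (j - p))).
  assert (F0 := INR_fact_neq_0).
  replace (RtoC (/ INR (fact (j - p))) * y ^ (j - p) * (RtoC (a * b / INR (fact p)) * F p)) with
    (RtoC (/ INR (fact (j - p)) * (a * b / INR (fact p))) * (y ^ (j - p) * F p))
    by (rewrite RtoC_mult; ring).
  replace (/ INR (fact (j - p)) * (a * b / INR (fact p)))%R with
    (a / INR (fact j) * (INR (fact j) / INR (fact p) * (b / INR (fact (j - p)))))%R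
    by (field; auto).
  rewrite (RtoC_mult (a / INR (fact j))). ring.
Qed.

(** The coefficient of the bracket is split between the two factors so that either becomes
    an Appell sequence in [aut_twist M z] by [lift_coef_appell]; then [appell_convolution]
    removes all terms but those of index [p = j], whose weights add up. *)
Theorem rankin_cohen_slash (k l : Z) (n : nat) (M : SL2Z) (f g : C -> C) (z : C) :
  smooth f -> smooth g -> upper_half_plane z ->
  rankin_cohen k l n (slash k f M) (slash l g M) z =
  slash (k + l + 2 * Z.of_nat n) (rankin_cohen k l n f g) M z.
Proof.
  intros Hf Hg Hz. assert (HJ := aut_factor_neq_0 M z Hz).
  set (Y := aut_twist M z).
  set (a := fun (k : Z) (j : nat) =>
    RtoC (IZR (falling (k + Z.of_nat n - 1) (n - j)) / INR (fact j))).
  set (A := fun p => a k p * slash_Dn k M f p z).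
  set (B := fun p => a l p * slash_Dn l M g p z).
  assert (Hab : forall j, (j <= n)%nat ->
    gbinom (k + Z.of_nat n - 1) (n - j) * gbinom (l + Z.of_nat n - 1) j
    = a k j * a l (n - j)%nat).
  { intros j Hj. unfold a, gbinom. replace (n - (n - j))%nat with j by lia.
    rewrite <- !RtoC_mult. f_equal. field. split; apply INR_fact_neq_0. }
  transitivity (sum_n (G := C_AbelianGroup)
    (fun j => (-1) ^ j * (appell A j Y * appell B (n - j) Y)) n).
  - unfold rankin_cohen. apply (sum_n_ext_loc (G := C_AbelianGroup)). intros j Hj.
    eq_in_C.
    unfold A, B, a. rewrite <- (lift_coef_appell k n j) by easy.
    rewrite <- (lift_coef_appell l n (n - j)) by lia. fold (a k j). fold (a l (n - j)%nat).
    unfold Y. rewrite <- (proj2 (slash_smooth k M f Hf) j z Hz).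
    rewrite <- (proj2 (slash_smooth l M g Hg) (n - j)%nat z Hz).
    transitivity ((-1) ^ j * (gbinom (k + Z.of_nat n - 1) (n - j) *
      gbinom (l + Z.of_nat n - 1) j) * Dn j (slash k f M) z * Dn (n - j) (slash l g M) z);
      [ring|]. rewrite Hab by easy. ring.
  - rewrite appell_convolution. unfold slash, rankin_cohen.
    rewrite <- sum_n_scal_C. apply (sum_n_ext_loc (G := C_AbelianGroup)). intros j Hj.
    eq_in_C.
    unfold A, B, slash_Dn, slash.
    fold (aut_factor M z). fold (moebius M z).
    replace (- (k + l + 2 * Z.of_nat n))%Z with
      (- (k + 2 * Z.of_nat j) + - (l + 2 * Z.of_nat (n - j)))%Z by lia.
    rewrite CpowZ_add by easy.
    set (u := CpowZ _ _). set (v := CpowZ _ _).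
    transitivity (u * v * ((-1) ^ j * (gbinom (k + Z.of_nat n - 1) (n - j) *
      gbinom (l + Z.of_nat n - 1) j) * Dn j f (moebius M z) * Dn (n - j) g (moebius M z)));
      [|ring]. rewrite Hab by easy. ring.
Qed.

(** * Unordered sums *)

Definition eq_dec_classical {I : Type} (x y : I) : {x = y} + {x <> y} :=
  excluded_middle_informative (x = y).

#[global] Instance finite_subsets_proper (I : Type) : ProperFilter (finite_subsets I).
Proof.
  constructor.
  - intros P [s0 H]. exists (nodup eq_dec_classical s0). apply H; [apply NoDup_nodup|].
    intros x Hx. now apply nodup_In.
  - constructor.
    + now exists nil.
    + intros P Q [s1 H1] [s2 H2]. exists (s1 ++ s2). intros s Hs Hi.
      split; [apply H1|apply H2]; try easy; intros x Hx; apply Hi, in_or_app; tauto.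
    + intros P Q HPQ [s0 H]. exists s0. intros s Hs Hi. now apply HPQ, H.
Qed.

Lemma fin_sum_app {I : Type} {G : AbelianGroup} (g : I -> G) (s t : list I) :
  fin_sum g (s ++ t) = plus (fin_sum g s) (fin_sum g t).
Proof.
  induction s as [|x s IH]; [symmetry; apply plus_zero_l|].
  change (plus (g x) (fin_sum g (s ++ t)) = plus (plus (g x) (fin_sum g s)) (fin_sum g t)).
  rewrite IH. apply plus_assoc.
Qed.

Lemma fin_sum_le {I : Type} (u v : I -> R) (s : list I) :
  (forall x, In x s -> u x <= v x) ->
  fin_sum (G := R_AbelianGroup) u s <= fin_sum (G := R_AbelianGroup) v s.
Proof.
  induction s as [|x s IH]; intros H; [apply Rle_refl|].
  apply Rplus_le_compat; [apply H; now left|]. apply IH. intros y Hy. apply H. now right.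
Qed.

Lemma fin_sum_le_incl {I : Type} (u : I -> R) (s t : list I) :
  (forall x, 0 <= u x) -> NoDup s -> incl s t ->
  fin_sum (G := R_AbelianGroup) u s <= fin_sum (G := R_AbelianGroup) u t.
Proof.
  intros Hu. revert t. induction s as [|x s IH]; intros t Hs Hi.
  - clear Hi. induction t as [|y t IH]; [apply Rle_refl|].
    apply Rle_trans with (1 := IH). change (fin_sum (G := R_AbelianGroup) u t
      <= u y + fin_sum (G := R_AbelianGroup) u t). generalize (Hu y). lra.
  - inversion_clear Hs as [|? ? Hx Hs'].
    destruct (in_split x t (Hi x (or_introl eq_refl))) as [t1 [t2 ->]].
    assert (H : fin_sum (G := R_AbelianGroup) u s
                <= fin_sum (G := R_AbelianGroup) u (t1 ++ t2)).
    { apply IH; [easy|]. intros y Hy.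
      destruct (in_app_or _ _ _ (Hi y (or_intror Hy))) as [H|[H|H]];
        [apply in_or_app; now left|now subst y|apply in_or_app; now right]. }
    rewrite fin_sum_app in H |- *.
    change (u x + fin_sum (G := R_AbelianGroup) u s <=
      fin_sum (G := R_AbelianGroup) u t1 + (u x + fin_sum (G := R_AbelianGroup) u t2)).
    change (fin_sum (G := R_AbelianGroup) u s <=
      fin_sum (G := R_AbelianGroup) u t1 + fin_sum (G := R_AbelianGroup) u t2) in H.
    lra.
Qed.

Lemma fin_sum_cons_R {I : Type} (u : I -> R) (x : I) (s : list I) :
  fin_sum (G := R_AbelianGroup) u (x :: s) = (u x + fin_sum (G := R_AbelianGroup) u s)%R.
Proof. reflexivity. Qed.

Lemma fin_sum_filter {I : Type} (u : I -> R) (p : I -> bool) (s : list I) :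
  fin_sum (G := R_AbelianGroup) u s =
  (fin_sum (G := R_AbelianGroup) u (filter p s)
   + fin_sum (G := R_AbelianGroup) u (filter (fun x => negb (p x)) s))%R.
Proof.
  induction s as [|x s IH]; [symmetry; apply Rplus_0_l|].
  simpl filter. destruct (p x); simpl negb; cbv iota; rewrite !fin_sum_cons_R, IH;
  eq_in_R; ring.
Qed.

Lemma fin_sum_Re_Im {I : Type} (g : I -> C) (s : list I) :
  Re (fin_sum (G := C_AbelianGroup) g s) = fin_sum (G := R_AbelianGroup) (fun x => Re (g x)) s
  /\ Im (fin_sum (G := C_AbelianGroup) g s) = fin_sum (G := R_AbelianGroup) (fun x => Im (g x)) s.
Proof.
  induction s as [|x s [IH1 IH2]]; [now split|].
  rewrite !fin_sum_cons_R, <- IH1, <- IH2. now split.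
Qed.

(** Splitting [s] by the sign of [u]: a bound on all subsums bounds the sum of the absolute
    values. *)
Lemma fin_sum_abs_le {I : Type} (u : I -> R) (B : R) (s : list I) : 
  (forall p, Rabs (fin_sum (G := R_AbelianGroup) u (filter p s)) <= B) ->
  fin_sum (G := R_AbelianGroup) (fun x => Rabs (u x)) s <= 2 * B.
Proof.
  intros H.
  set (p := fun x => if Rle_dec 0 (u x) then true else false).
  rewrite (fin_sum_filter _ p).
  assert (H1 := Rle_trans _ _ _ (Rle_abs _) (H p)).
  assert (H2 := H (fun x => negb (p x))). rewrite <- Rabs_Ropp in H2.
  apply (Rle_trans _ _ _ (Rle_abs _)) in H2.
  assert (E1 : fin_sum (G := R_AbelianGroup) (fun x => Rabs (u x)) (filter p s)
               <= fin_sum (G := R_AbelianGroup) u (filter p s)).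
  { apply fin_sum_le. intros x Hx. apply filter_In in Hx as [_ Hx]. unfold p in Hx.
    destruct (Rle_dec 0 (u x)) as [Hu|]; [|easy]. rewrite Rabs_pos_eq; lra. }
  assert (E2 : forall t, (forall x, In x t -> u x < 0) ->
    fin_sum (G := R_AbelianGroup) (fun x => Rabs (u x)) t
    = (- fin_sum (G := R_AbelianGroup) u t)%R).
  { induction t as [|x t IH]; intros Ht; [symmetry; exact Ropp_0|].
    rewrite !fin_sum_cons_R, IH, Rabs_left; [symmetry; apply Ropp_plus_distr|apply Ht; now left|].
    intros y Hy. apply Ht. now right. }
  rewrite (E2 (filter (fun x => negb (p x)) s)).
  - replace (2 * B)%R with (B + B)%R by ring.
    exact (Rplus_le_compat _ _ _ _ (Rle_trans _ _ _ E1 H1) H2).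
  - intros x Hx. apply filter_In in Hx as [_ Hx]. unfold p in Hx.
    destruct (Rle_dec 0 (u x)) as [|Hu]; [easy|]. lra.
Qed.

(** Sums over finite sets that avoid a suitable finite set [s1] are bounded, by the Cauchy
    criterion; hence so are the sums of the moduli, and the supremum of these is their
    unordered sum. *)
Lemma ex_unordered_sum_Cmod {I : Type} (g : I -> C) (l : C) :
  is_unordered_sum (V := C_NormedModule) g l ->
  ex_unordered_sum (V := R_NormedModule) (fun x => Cmod (g x)).
Proof.
  intros Hg.
  assert (Hg1 := proj1 (filterlim_C_iff (finite_subsets I) _ l) Hg 1%R Rlt_0_1).
  destruct Hg1 as [s0 Hs0].
  set (s1 := nodup eq_dec_classical s0).
  assert (Hs1 : NoDup s1) by apply NoDup_nodup.
  assert (Hi1 : incl s0 s1) by (intros x Hx; now apply nodup_In).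
  set (S := (fun s => fin_sum (G := R_AbelianGroup) (fun x => Cmod (g x)) s) : list I -> R).
  assert (Hdisj : forall s, NoDup s -> (forall x, In x s -> ~ In x s1) ->
    Cmod (fin_sum (G := C_AbelianGroup) g s) <= 2).
  { intros s Hs Hd.
    assert (N : NoDup (s ++ s1)) by (apply NoDup_app; easy).
    assert (H1 := Hs0 s1 Hs1 Hi1).
    assert (H2 := Hs0 (s ++ s1) N (fun x Hx => in_or_app _ _ _ (or_intror (Hi1 x Hx)))).
    assert (E : fin_sum (G := C_AbelianGroup) g (s ++ s1) =
      fin_sum (G := C_AbelianGroup) g s + fin_sum (G := C_AbelianGroup) g s1)
      by exact (fin_sum_app (G := C_AbelianGroup) g s s1).
    change (Cmod (fin_sum (G := C_AbelianGroup) g (s ++ s1) - l) < 1) in H2.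
    change (Cmod (fin_sum (G := C_AbelianGroup) g s1 - l) < 1) in H1.
    rewrite E in H2. 
    replace (fin_sum (G := C_AbelianGroup) g s) with
      ((fin_sum (G := C_AbelianGroup) g s + fin_sum (G := C_AbelianGroup) g s1 - l)
       + - (fin_sum (G := C_AbelianGroup) g s1 - l))
      by (eq_in_C; ring).
    eapply Rle_trans; [apply Cmod_triangle|]. rewrite Cmod_opp. lra. }
  (* Real and imaginary parts, and positive and negative terms: four times the bound. *)
  assert (Hdisj2 : forall s, NoDup s -> (forall x, In x s -> ~ In x s1) -> S s <= 8).
  { intros s Hs Hd.
    assert (Hp : forall p, Cmod (fin_sum (G := C_AbelianGroup) g (filter p s)) <= 2).
    { intros p. apply Hdisj; [now apply NoDup_filter|].
      intros x Hx. apply filter_In in Hx as [Hx _]. now apply Hd. }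
    assert (H1 := fin_sum_abs_le (fun x => Re (g x)) 2 s).
    assert (H2 := fin_sum_abs_le (fun x => Im (g x)) 2 s).
    assert (H3 : S s <= fin_sum (G := R_AbelianGroup) (fun x => Rabs (Re (g x))) s
      + fin_sum (G := R_AbelianGroup) (fun x => Rabs (Im (g x))) s).
    { unfold S. clear. induction s as [|x s IH]; [right; symmetry; apply Rplus_0_l|].
      rewrite !fin_sum_cons_R. generalize (Cmod_le_Re_Im (g x)). lra. }
    eapply Rle_trans; [exact H3|]. replace 8%R with (2 * 2 + 2 * 2)%R by ring.
    apply Rplus_le_compat; [apply H1|apply H2]; intros p; (eapply Rle_trans; [|apply (Hp p)]).
    - rewrite <- (proj1 (fin_sum_Re_Im g (filter p s))). apply re_le_Cmod.
    - rewrite <- (proj2 (fin_sum_Re_Im g (filter p s))). apply im_le_Cmod. }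
  assert (Hbd : forall s, NoDup s -> S s <= S s1 + 8).
  { intros s Hs. unfold S.
    set (p := fun x => if in_dec eq_dec_classical x s1 then true else false).
    rewrite (fin_sum_filter _ p s). apply Rplus_le_compat.
    - apply fin_sum_le_incl; [intros; apply Cmod_ge_0|now apply NoDup_filter|].
      intros x Hx. apply filter_In in Hx as [_ Hx]. unfold p in Hx.
      now destruct (in_dec eq_dec_classical x s1).
    - apply Hdisj2; [now apply NoDup_filter|].
      intros x Hx. apply filter_In in Hx as [_ Hx]. unfold p in Hx.
      now destruct (in_dec eq_dec_classical x s1). }
  destruct (completeness (fun y => exists s, NoDup s /\ y = S s)) as [L [HL1 HL2]].
  { exists (S s1 + 8)%R. intros y [s [Hs ->]]. now apply Hbd. }
  { exists (S nil), nil. split; [constructor|easy]. }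
  exists L. apply (filterlim_locally (U := R_UniformSpace)). intros eps.
  assert (Hex : exists s, NoDup s /\ L - eps < S s).
  { apply NNPP. intros H.
    assert (HL : L <= L - eps).
    { apply HL2. intros y [s [Hs ->]]. apply Rnot_lt_le. intros Hlt. apply H. now exists s. }
    generalize (cond_pos eps). lra. }
  destruct Hex as [s2 [Hs2 Hs2']]. exists s2. intros s Hs Hi.
  assert (H1 : S s2 <= S s)
    by (apply fin_sum_le_incl; [intros; apply Cmod_ge_0|easy|easy]).
  assert (H2 : S s <= L) by (apply HL1; now exists s).
  change (Rabs (S s - L) < eps). generalize (cond_pos eps). intros.
  apply Rabs_def1; lra.
Qed.

(** * Compact sets and locally uniform convergence *)

(** Choose for each point of the square a member of the covering and a radius, and apply the
    compactness of a box to this gauge.  The choice is extended by junk values outside of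
    the square, which the filter on the finite list of centres then removes. *)
Lemma compact_square (z : C) (r : R) :
  compact_set (T := C_UniformSpace)
    (fun w => Rabs (Re w - Re z) <= r /\ Rabs (Im w - Im z) <= r).
Proof.
  intros F HF Hcov.
  set (X := fun w : C => Rabs (Re w - Re z) <= r /\ Rabs (Im w - Im z) <= r).
  set (pt := fun t : Compactness.Tn 2 R => (fst t, fst (snd t)) : C).
  assert (Hch : forall t, exists dU : posreal * (C -> Prop), X (pt t) ->
    F (snd dU) /\ forall w, ball (M := C_UniformSpace) (pt t) (fst dU) w -> snd dU w).
  { intros t. destruct (excluded_middle_informative (X (pt t))) as [Ht|Ht].
    - destruct (Hcov _ Ht) as [U [HU HUt]]. destruct (HF U HU _ HUt) as [d Hd].
      now exists (d, U).
    - exists (mkposreal 1 Rlt_0_1, fun _ => True). easy. }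
  set (dU := fun t => epsilon (inhabits (mkposreal 1 Rlt_0_1, fun _ : C => True))
    (fun dU : posreal * (C -> Prop) => X (pt t) ->
    F (snd dU) /\ forall w, ball (M := C_UniformSpace) (pt t) (fst dU) w -> snd dU w)).
  assert (HdU : forall t, X (pt t) -> F (snd (dU t)) /\
    forall w, ball (M := C_UniformSpace) (pt t) (fst (dU t)) w -> snd (dU t) w)
    by (intros t; exact (epsilon_spec _ _ (Hch t))).
  set (a := ((Re z - r)%R, ((Im z - r)%R, tt)) : Compactness.Tn 2 R).
  set (b := ((Re z + r)%R, ((Im z + r)%R, tt)) : Compactness.Tn 2 R).
  assert (Hb : forall t, bounded_n 2 a b t <-> X (pt t)).
  { intros [t1 [t2 []]]. unfold X, pt, Re, Im; simpl. rewrite !Rcomplements.Rabs_le_between.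
    split; [intros [H1 [H2 _]]|intros [H1 H2]]; unfold Re, Im in *;
      repeat split; lra. }
  destruct (NNPP _ (compactness_list 2 a b (fun t => fst (dU t)))) as [l Hl].
  exists (map (fun t => snd (dU t))
    (filter (fun t => if excluded_middle_informative (X (pt t)) then true else false) l)).
  split.
  - intros U HU. apply in_map_iff in HU as [t [<- Ht]]. apply filter_In in Ht as [_ Ht].
    destruct (excluded_middle_informative (X (pt t))) as [HX|]; [|easy]. now apply HdU.
  - intros w Hw.
    destruct (Hl (fst w, (snd w, tt))) as [t [Ht1 [Ht2 Ht3]]].
    { apply Hb. unfold pt; simpl. now destruct w. }
    apply Hb in Ht2. exists (snd (dU t)). split.
    + apply in_map_iff. exists t. split; [easy|]. apply filter_In. split; [easy|].
      now destruct (excluded_middle_informative (X (pt t))).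
    + apply HdU; [easy|]. destruct t as [t1 [t2 []]]. simpl in Ht3. now split.
Qed.

(** The covering consists of the open sets on which convergence is uniform up to [eps]. *)
Lemma loc_unif_compact {T : Type} (F : (T -> Prop) -> Prop) {FF : Filter F}
  (G : T -> C -> C) (g : C -> C) (X : C -> Prop) :
  loc_unif F G g -> compact_set (T := C_UniformSpace) X ->
  (forall z, X z -> upper_half_plane z) ->
  forall eps : R, 0 < eps -> F (fun t => forall z, X z -> Cmod (G t z - g z) < eps).
Proof.
  intros H HX HXH eps Heps.
  destruct (HX (fun U => open U /\ F (fun t => forall z, U z -> Cmod (G t z - g z) < eps)))
    as [l [Hl1 Hl2]].
  - now intros U [HU _].
  - intros z Hz. destruct (H z (HXH z Hz)) as [r [Hr Hu]].
    exists (fun w => locally (T := C_UniformSpace) w (fun w' => Cmod (w' - z) < r)).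
    split; [split|].
    + intros w Hw. now apply locally_locally.
    + generalize (Hu eps Heps). apply filter_imp. intros t Ht w Hw.
      apply Ht. exact (locally_singleton _ _ Hw).
    + apply locally_C. now apply locally_Cmod with r.
  - assert (Hall : F (fun t => forall U, In U l -> forall z, U z -> Cmod (G t z - g z) < eps)).
    { clear Hl2. induction l as [|U l IH].
      - apply filter_forall. intros t U [].
      - assert (H1 := proj2 (Hl1 U (or_introl eq_refl))).
        assert (H2 := IH (fun V HV => Hl1 V (or_intror HV))).
        generalize (filter_and _ _ H1 H2). apply filter_imp.
        intros t [Ht1 Ht2] V [<-|HV]; [exact Ht1|now apply Ht2]. }
    revert Hall. apply filter_imp. intros t Ht z Hz.
    destruct (Hl2 z Hz) as [U [HU HUz]]. exact (Ht U HU z HUz).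
Qed.

Lemma loc_unif_plus {T : Type} (F : (T -> Prop) -> Prop) {FF : Filter F}
  (G G' : T -> C -> C) (g g' : C -> C) :
  loc_unif F G g -> loc_unif F G' g' ->
  loc_unif F (fun t z => G t z + G' t z) (fun z => g z + g' z).
Proof.
  intros H H' z Hz. destruct (H z Hz) as [r [Hr Hu]]. destruct (H' z Hz) as [r' [Hr' Hu']].
  exists (Rmin r r'). split; [now apply Rmin_pos|]. intros eps Heps.
  assert (He : 0 < eps / 2) by lra.
  generalize (filter_and _ _ (Hu _ He) (Hu' _ He)). apply filter_imp.
  intros t [Ht Ht'] w Hw.
  specialize (Ht w (Rlt_le_trans _ _ _ Hw (Rmin_l _ _))).
  specialize (Ht' w (Rlt_le_trans _ _ _ Hw (Rmin_r _ _))).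
  replace (G t w + G' t w - (g w + g' w)) with ((G t w - g w) + (G' t w - g' w)) by ring.
  eapply Rle_lt_trans; [apply Cmod_triangle|]. lra.
Qed.

Lemma loc_unif_mult_l {T : Type} (F : (T -> Prop) -> Prop) {FF : Filter F}
  (h : C -> C) (G : T -> C -> C) (g : C -> C) :
  smooth h -> loc_unif F G g ->
  loc_unif F (fun t z => h z * G t z) (fun z => h z * g z).
Proof.
  intros Hh H z Hz. destruct (H z Hz) as [r [Hr Hu]].
  destruct (is_cderive_continuous h z _ (Hh 0%nat z Hz) 1%R Rlt_0_1) as [d [Hd Hc]].
  exists (Rmin r d). split; [now apply Rmin_pos|]. intros eps Heps.
  assert (HM : 0 < Cmod (h z) + 1) by (generalize (Cmod_ge_0 (h z)); lra).
  generalize (Hu (eps / (Cmod (h z) + 1))%R (Rdiv_lt_0_compat _ _ Heps HM)).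
  apply filter_imp. intros t Ht w Hw.
  specialize (Ht w (Rlt_le_trans _ _ _ Hw (Rmin_l _ _))).
  specialize (Hc w (Rlt_le_trans _ _ _ Hw (Rmin_r _ _))).
  replace (h w * G t w - h w * g w) with (h w * (G t w - g w)) by ring.
  rewrite Cmod_mult.
  assert (Hhw : Cmod (h w) <= Cmod (h z) + 1).
  { replace (h w) with ((h w - h z) + h z) by ring.
    eapply Rle_trans; [apply Cmod_triangle|]. lra. }
  apply Rle_lt_trans with ((Cmod (h z) + 1) * Cmod (G t w - g w))%R.
  - apply Rmult_le_compat_r; [apply Cmod_ge_0|easy].
  - apply Rmult_lt_compat_l with (r := (Cmod (h z) + 1)%R) in Ht; [|easy].
    eapply Rlt_le_trans; [exact Ht|]. right. field. lra.
Qed.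

Lemma loc_unif_sum_n {T : Type} (F : (T -> Prop) -> Prop) {FF : Filter F}
  (G : nat -> T -> C -> C) (g : nat -> C -> C) (n : nat) :
  (forall j, loc_unif F (G j) (g j)) ->
  loc_unif F (fun t z => sum_n (G := C_AbelianGroup) (fun j => G j t z) n)
    (fun z => sum_n (G := C_AbelianGroup) (fun j => g j z) n).
Proof.
  intros H. induction n as [|n IH].
  - apply (loc_unif_ext F (G 0%nat) _ (g 0%nat)); [| |apply H];
      intros; now rewrite sum_O.
  - apply (loc_unif_ext F
      (fun t z => sum_n (G := C_AbelianGroup) (fun j => G j t z) n + G (S n) t z) _
      (fun z => sum_n (G := C_AbelianGroup) (fun j => g j z) n + g (S n) z));
      [| |now apply loc_unif_plus]; intros; now rewrite sum_Sn.
Qed.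

(** * Poincaré series *)

Lemma unordered_sum_eq {I : Type} (g : I -> C) (l : C) :
  is_unordered_sum (V := C_NormedModule) g l ->
  unordered_sum (V := C_CompleteNormedModule) g = l.
Proof.
  intros H. exact (iota_filterlim_locally (V := C_CompleteNormedModule)
    (F := finite_subsets I) (fin_sum (G := C_AbelianGroup) g) l H).
Qed.

(** A closed square of half-width [Im z / 2] around [z] is a compact subset of the
    half-plane that contains a disc. *)
Lemma poincare_well_defined_loc_unif (k : Z) (phi : C -> C) :
  poincare_well_defined k phi ->
  loc_unif (finite_subsets coset)
    (fun s z => fin_sum (G := C_AbelianGroup) (poincare_term k phi z) s) (poincare k phi).
Proof.
  intros [_ H] z Hz. exists (Im z / 2)%R. unfold upper_half_plane in Hz. split; [lra|].
  intros eps Heps.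
  generalize (H _ (compact_square z (Im z / 2)%R)). intros H1.
  refine (filter_imp _ _ _ (H1 _ (mkposreal eps Heps))).
  - intros s Hs w Hw. apply Hs.
    replace (Re w - Re z)%R with (Re (w - z)) by (unfold Re; simpl; ring).
    replace (Im w - Im z)%R with (Im (w - z)) by (unfold Im; simpl; ring).
    generalize (re_le_Cmod (w - z)) (im_le_Cmod (w - z)). lra.
  - intros w [_ Hw]. unfold upper_half_plane.
    generalize (Rle_abs (- (Im w - Im z))). rewrite Rabs_Ropp. lra.
Qed.

(** Identifying a locally uniform limit of the partial sums suffices, since it is then the
    unordered sum and absolute convergence is automatic. *)
Lemma loc_unif_poincare (k : Z) (phi P : C -> C) :
  loc_unif (finite_subsets coset)
    (fun s z => fin_sum (G := C_AbelianGroup) (poincare_term k phi z) s) P ->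
  poincare_well_defined k phi /\
  forall z, upper_half_plane z -> poincare k phi z = P z.
Proof.
  intros H.
  assert (Hsum : forall z, upper_half_plane z ->
    is_unordered_sum (V := C_NormedModule) (poincare_term k phi z) (P z)).
  { intros z Hz. apply (filterlim_C_iff (finite_subsets coset)).
    exact (loc_unif_pointwise (finite_subsets coset) _ P z H Hz). }
  assert (HP : forall z, upper_half_plane z -> poincare k phi z = P z).
  { intros z Hz. now apply unordered_sum_eq, Hsum. }
  split; [split|exact HP].
  - intros z Hz. now apply (ex_unordered_sum_Cmod _ (P z)), Hsum.
  - intros X HX HXH eps.
    generalize (loc_unif_compact _ _ _ X H HX HXH eps (cond_pos eps)).
    apply filter_imp. intros s Hs z Hz. rewrite (HP z (HXH z Hz)). now apply Hs.
Qed.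

Lemma rankin_cohen_ext_l (k l : Z) (n : nat) (f f' g : C -> C) (z : C) :
  smooth f -> (forall w, upper_half_plane w -> f w = f' w) -> upper_half_plane z ->
  rankin_cohen k l n f g z = rankin_cohen k l n f' g z.
Proof.
  intros Hf H Hz. unfold rankin_cohen. apply (sum_n_ext (G := C_AbelianGroup)). intros j.
  now rewrite (Dn_ext f f' j Hf H z Hz).
Qed.

Lemma sum_n_fin_sum {I : Type} (c : nat -> C) (u : I -> nat -> C) (s : list I) (n : nat) :
  sum_n (G := C_AbelianGroup) (fun j => c j * fin_sum (G := C_AbelianGroup)
    (fun i => u i j) s) n =
  fin_sum (G := C_AbelianGroup)
    (fun i => sum_n (G := C_AbelianGroup) (fun j => c j * u i j) n) s.
Proof.
  induction s as [|i s IH].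
  - change (sum_n (G := C_AbelianGroup) (fun j => c j * 0) n = RtoC 0).
    rewrite (sum_n_ext (G := C_AbelianGroup) _ (fun j => 0 * RtoC 0)).
    + rewrite sum_n_scal_C. exact (Cmult_0_l _).
    + intros j. eq_in_C. ring.
  - change (sum_n (G := C_AbelianGroup) (fun j => c j * (u i j + fin_sum (G := C_AbelianGroup)
      (fun i => u i j) s)) n =
      sum_n (G := C_AbelianGroup) (fun j => c j * u i j) n + fin_sum (G := C_AbelianGroup)
      (fun i => sum_n (G := C_AbelianGroup) (fun j => c j * u i j) n) s).
    rewrite <- IH, <- sum_n_plus_C. apply (sum_n_ext (G := C_AbelianGroup)). intros j.
    apply Cmult_plus_distr_l.
Qed.

Lemma rankin_cohen_fin_sum {I : Type} (k l : Z) (n : nat) (f : C -> C) (g : I -> C -> C)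
  (s : list I) (z : C) :
  (forall i, smooth (g i)) -> upper_half_plane z ->
  rankin_cohen k l n f (fun w => fin_sum (G := C_AbelianGroup) (fun i => g i w) s) z =
  fin_sum (G := C_AbelianGroup) (fun i => rankin_cohen k l n f (g i) z) s.
Proof.
  intros Hg Hz. unfold rankin_cohen.
  rewrite <- (sum_n_fin_sum
    (fun j => (-1) ^ j * gbinom (k + Z.of_nat n - 1) (n - j) * gbinom (l + Z.of_nat n - 1) j
      * Dn j f z) (fun i j => Dn (n - j) (g i) z)).
  apply (sum_n_ext (G := C_AbelianGroup)). intros j.
  now rewrite (proj2 (smooth_fin_sum g s Hg) (n - j)%nat z Hz).
Qed.

(** This is where Weierstrass' theorem enters: the bracket involves derivatives of [G t]. *)
Lemma loc_unif_rankin_cohen {T : Type} (F : (T -> Prop) -> Prop) {FF : ProperFilter F}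
  (k l : Z) (n : nat) (f : C -> C) (G : T -> C -> C) (g : C -> C) :
  smooth f -> (forall t, smooth (G t)) -> loc_unif F G g ->
  loc_unif F (fun t => rankin_cohen k l n f (G t)) (rankin_cohen k l n f g).
Proof.
  intros Hf HG H. destruct (Weierstrass F G g HG H) as [_ HD].
  unfold rankin_cohen. apply (loc_unif_sum_n F
    (fun j t z => (-1) ^ j * gbinom (k + Z.of_nat n - 1) (n - j)
      * gbinom (l + Z.of_nat n - 1) j * Dn j f z * Dn (n - j) (G t) z)
    (fun j z => (-1) ^ j * gbinom (k + Z.of_nat n - 1) (n - j)
      * gbinom (l + Z.of_nat n - 1) j * Dn j f z * Dn (n - j) g z)).
  intros j. apply (loc_unif_mult_l F (fun z => (-1) ^ j * gbinom (k + Z.of_nat n - 1) (n - j)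
      * gbinom (l + Z.of_nat n - 1) j * Dn j f z)); [|apply HD].
  apply (smooth_scal (Dn j f)). now apply smooth_Dn.
Qed.

Theorem corollary3
  (k l : Z) (m : nat) (f phi : C -> C) (a : nat -> C)
  (Hk : Z.Even k) (Hf : is_modular_form k f)
  (Hl : Z.Even l) (Hl4 : (4 <= l)%Z)
  (Hkl : ~ is_cusp_form k f -> (k + 2 <= l)%Z)
  (Hphi : has_q_expansion a phi)
  (HP : poincare_well_defined l phi) :
  poincare_well_defined (k + l + 2 * Z.of_nat m) (rankin_cohen k l m f phi) /\
  forall tau : C, upper_half_plane tau ->
    rankin_cohen k l m f (poincare l phi) tau =
    poincare (k + l + 2 * Z.of_nat m) (rankin_cohen k l m f phi) tau.
Proof.
  destruct Hf as [_ [Hinv [b Hb]]].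
  assert (Sf := q_series_smooth b f Hb).
  assert (Sphi := q_series_smooth a phi Hphi).
  assert (Sterm : forall A : coset, smooth (fun z => poincare_term l phi z A))
    by (intros A; apply (slash_smooth l (coset_repr A) phi Sphi)).
  assert (Hterm : forall A z, upper_half_plane z ->
    rankin_cohen k l m f (fun z => poincare_term l phi z A) z =
    poincare_term (k + l + 2 * Z.of_nat m) (rankin_cohen k l m f phi) z A).
  { intros A z Hz. unfold poincare_term. set (M := coset_repr A).
    rewrite (rankin_cohen_ext_l k l m f (slash k f M)); [|easy| |easy].
    - now apply rankin_cohen_slash.
    - intros w Hw. symmetry. now apply Hinv. }
  destruct (loc_unif_poincare (k + l + 2 * Z.of_nat m) (rankin_cohen k l m f phi)
    (rankin_cohen k l m f (poincare l phi))) as [H1 H2].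
  - apply (loc_unif_ext (finite_subsets coset) (fun s => rankin_cohen k l m f
      (fun z => fin_sum (G := C_AbelianGroup) (poincare_term l phi z) s)) _
      (rankin_cohen k l m f (poincare l phi))).
    + intros s z Hz.
      refine (eq_trans (rankin_cohen_fin_sum k l m f (fun A z => poincare_term l phi z A)
        s z Sterm Hz) _).
      f_equal. apply functional_extensionality. intros A. now apply Hterm.
    + easy.
    + apply (loc_unif_rankin_cohen (finite_subsets coset)); [exact Sf| |].
      * intros s. apply (smooth_fin_sum (fun A z => poincare_term l phi z A) s Sterm).
      * now apply poincare_well_defined_loc_unif.
  - split; [exact H1|]. intros tau Htau. symmetry. now apply H2.
Qed.
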